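(* There are no units of order $6$ in $\mathrm{V}(\mathbb{Z}M_{10})$ and there are no units of order $6$ in $\mathrm{V}(\mathbb{Z}\,\mathrm{PGL}(2,9))$.
   Context: For a finite group $G$, $\mathbb{Z}G$ denotes the integral group ring and $\mathrm{V}(\mathbb{Z}G)$ the group of units of $\mathbb{Z}G$ of augmentation one, where the augmentation is $\sum_{g\in G} a_g g \mapsto \sum_{g \in G} a_g$. $M_{10}$ denotes the Mathieu group of degree $10$; both $M_{10}$ and $\mathrm{PGL}(2,9)$ are subgroups of index $2$ in $\mathrm{Aut}(A_6)$ containing $A_6$ ($M_{10}$ being the one isomorphic neither to $S_6$ nor to $\mathrm{PGL}(2,9)$). *)

(* Defs.v *)
From HB Require Import structures.
From mathcomp Require Import all_boot all_algebra all_fingroup all_solvable all_field.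
From mathcomp Require Import ring.

Set Implicit Arguments.
Unset Strict Implicit.
Unset Printing Implicit Defensive.

Import GRing.Theory.
Local Open Scope ring_scope.

(* A named copy of the function type: {ffun gT -> R} itself carries the      *)
(* pointwise product.                                                         *)
Definition group_ring (R : nzRingType) (gT : finGroupType) : Type :=
  {ffun gT -> R}.

HB.instance Definition _ (R : nzRingType) (gT : finGroupType) :=
  GRing.Zmodule.copy (group_ring R gT) {ffun gT -> R}.

Section GroupRing.

Variables (R : nzRingType) (gT : finGroupType).

Implicit Types a b c : group_ring R gT.

Definition coef a (g : gT) : R := (a : {ffun gT -> R}) g.

Definition gr_one : group_ring R gT := [ffun g : gT => (g == 1%g)%:R : R].

Definition gr_mul a b : group_ring R gT :=
  [ffun g : gT => \sum_(h : gT) coef a h * coef b (h^-1 * g)%g : R].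

Lemma gr_mulA : associative gr_mul.
Proof.
move=> a b c; apply/ffunP=> g; rewrite !ffunE /=.
under eq_bigr => h _ do rewrite /coef ffunE mulr_sumr.
under [RHS]eq_bigr => h _ do rewrite /coef ffunE mulr_suml.
rewrite [RHS]exchange_big /=; apply: eq_bigr => h _.
rewrite [RHS](reindex_inj (mulgI h)) /=; apply: eq_bigr => k _.
by rewrite mulrA invMg mulKg mulgA.
Qed.

Lemma gr_mul1l : left_id gr_one gr_mul.
Proof.
move=> a; apply/ffunP=> g; rewrite ffunE (bigD1 1%g) //= big1 ?addr0.
  by rewrite /coef ffunE eqxx mul1r invg1 mul1g.
by move=> h /negPf h1; rewrite /coef ffunE h1 mul0r.
Qed.

Lemma gr_mul1r : right_id gr_one gr_mul.
Proof.
move=> a; apply/ffunP=> g; rewrite ffunE (bigD1 g) //= big1 ?addr0.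
  by rewrite /coef ffunE mulVg eqxx mulr1.
move=> h /negPf hg; rewrite /coef ffunE.
by rewrite -(inj_eq (mulgI h)) mulKVg mulg1 eq_sym hg mulr0.
Qed.

Lemma gr_mulDl : left_distributive gr_mul +%R.
Proof.
move=> a b c; apply/ffunP=> g; rewrite !ffunE -big_split /=.
by apply: eq_bigr => h _; rewrite /coef ffunE mulrDl.
Qed.

Lemma gr_mulDr : right_distributive gr_mul +%R.
Proof.
move=> a b c; apply/ffunP=> g; rewrite !ffunE -big_split /=.
by apply: eq_bigr => h _; rewrite /coef ffunE mulrDr.
Qed.

Lemma gr_one_neq0 : gr_one != 0.
Proof.
apply/eqP=> /ffunP/(_ 1%g); rewrite !ffunE eqxx => /eqP.
by rewrite oner_eq0.
Qed.

HB.instance Definition _ := GRing.Zmodule_isNzRing.Build (group_ring R gT)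
  gr_mulA gr_mul1l gr_mul1r gr_mulDl gr_mulDr gr_one_neq0.

Definition augmentation (a : group_ring R gT) : R := \sum_(g : gT) coef a g.

End GroupRing.

Notation ZG G := (group_ring int (subg_of G)).

Definition invertible (R : nzRingType) (u : R) : Prop :=
  exists v : R, u * v = 1 /\ v * u = 1.

Definition normalized_unit (gT : finGroupType) (G : {group gT}) (u : ZG G) :
  Prop := invertible u /\ augmentation u = 1.

Definition has_order (R : nzRingType) (u : R) (n : nat) : Prop :=
  [/\ (0 < n)%N, u ^+ n = 1 & forall m : nat, (0 < m < n)%N -> u ^+ m <> 1].

Definition F9 : finFieldType :=
  s2val (pPrimePowerField (isT : prime 3) (isT : (0 < 2)%N)).

Lemma pchar_F9 : 3%N \in [pchar F9].
Proof. exact: (s2valP (pPrimePowerField _ _)). Qed.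

Lemma card_F9 : #|F9| = 9%N.
Proof. exact: (s2valP' (pPrimePowerField _ _)). Qed.

Definition PGL29 : {group coset_of 'Z('GL_2[F9])} :=
  ('GL_2[F9] / 'Z('GL_2[F9]))%G.

(* The projective line over F9 is option F9, with None the point at infinity; *)
(* homog_point x y is the point with homogeneous coordinates (x : y).         *)
Definition homog_point (x y : F9) : option F9 :=
  if y == 0 then None else Some (x / y).

Definition homog_coord (p : option F9) : F9 * F9 :=
  if p is Some x then (x, 1) else (1, 0).

(* z |-> (a f(z) + b) / (c f(z) + d) for a field automorphism f *)
Definition semilinear_frac (f : F9 -> F9) (a b c d : F9) (p : option F9) :
    option F9 :=
  let: (x, y) := homog_coord p in
  homog_point (a * f x + b * f y) (c * f x + d * f y).

Definition is_square (x : F9) : bool := [exists y : F9, x == y ^+ 2].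

Definition M10_twist (x : F9) : F9 -> F9 :=
  if is_square x then id else fun z => z ^+ 3.

(* M10 acting on the 10 points of the projective line: the maps               *)
(* z |-> (a z + b) / (c z + d) with a d - b c a nonzero square, together with *)
(* the maps z |-> (a z^3 + b) / (c z^3 + d) with a d - b c a non-square.      *)
Definition M10_set : {set {perm (option F9)}} :=
  [set s : {perm (option F9)} |
    [exists a : F9, exists b : F9, exists c : F9, exists d : F9,
      (a * d - b * c != 0) &&
      [forall p, s p ==
         semilinear_frac (M10_twist (a * d - b * c)) a b c d p]]].

Lemma M10_setP (s : {perm (option F9)}) :
  reflect (exists a b c d : F9, a * d - b * c != 0 /\
    s =1 semilinear_frac (M10_twist (a * d - b * c)) a b c d)
  (s \in M10_set).
Proof.
rewrite inE; apply: (iffP existsP) => [[a /existsP[b /existsP[c /existsP[d]]]]|].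
  by move=> /andP[D0 /forallP sE]; exists a, b, c, d; split=> // p; apply/eqP.
move=> [a [b [c [d [D0 sE]]]]]; exists a; apply/existsP; exists b.
apply/existsP; exists c; apply/existsP; exists d; rewrite D0 /=.
by apply/forallP=> p; rewrite sE.
Qed.

Lemma F9_generator :
  exists g : F9, [/\ g ^+ 8 = 1, forall i, g ^+ i = 1 -> (8 %| i)%N
    & forall x : F9, x != 0 -> exists i, x = g ^+ i].
Proof.
have /cyclicP[g gE] := field_unit_group_cyclic [set: {unit F9}]%G.
have og : #[g]%g = 8%N by rewrite /order -gE card_finField_unit card_F9.
have valX i : FinRing.uval (g ^+ i)%g = FinRing.uval g ^+ i by rewrite FinRing.val_unitX.
exists (FinRing.uval g); split=> [|i|x x0].
- by rewrite -valX -og expg_order.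
- rewrite -valX => gi1; rewrite -og order_dvdn; apply/eqP/val_inj.
  by rewrite /= gi1.
- have xU : x \is a GRing.unit by rewrite unitfE.
  have /cycleP[i xE] : FinRing.unit F9 xU \in <[g]>%g by rewrite -gE inE.
  by exists i; rewrite -valX -xE.
Qed.

Lemma is_squareP (x : F9) : reflect (exists y : F9, x = y ^+ 2) (is_square x).
Proof. by apply: (iffP existsP) => -[y /eqP]; exists y => //; apply/eqP. Qed.

Lemma is_square_gen (g : F9) : g ^+ 8 = 1 ->
    (forall i, g ^+ i = 1 -> (8 %| i)%N) ->
    (forall x : F9, x != 0 -> exists i, x = g ^+ i) ->
  forall i, is_square (g ^+ i) = ~~ odd i.
Proof.
move=> g8 gdvd gen i.
have g0 : g != 0.
  by apply/eqP=> g0; move: g8; rewrite g0 expr0n => /eqP; rewrite eq_sym oner_eq0.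
apply/is_squareP/idP => [[y yE]|/even_halfK iE].
  have y0 : y != 0.
    by apply/eqP=> y0; move: (expf_neq0 i g0); rewrite yE y0 expr0n eqxx.
  have [j yj] := gen y y0.
  have : g ^+ (i * 4) = 1.
    by rewrite exprM yE -exprM yj -exprM mulnC exprM g8 expr1n.
  move/gdvd; rewrite -[8%N]/(2 * 4)%N dvdn_pmul2r //.
  by rewrite dvdn2.
by exists (g ^+ i./2); rewrite -exprM muln2 iE.
Qed.

Lemma is_squareM (x y : F9) : x != 0 -> y != 0 ->
  is_square (x * y) = (is_square x == is_square y).
Proof.
have [g [g8 gdvd gen]] := F9_generator.
move=> /gen[i ->] /gen[j ->]; rewrite -exprD !(is_square_gen g8 gdvd gen) oddD.
by case: (odd i); case: (odd j).
Qed.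

Lemma is_square_exp3 (x : F9) : x != 0 -> is_square (x ^+ 3) = is_square x.
Proof.
have [g [g8 gdvd gen]] := F9_generator.
by move=> /gen[i ->]; rewrite -exprM !(is_square_gen g8 gdvd gen) oddM andbT.
Qed.

Lemma M10_twistD (D x y : F9) :
  M10_twist D (x + y) = M10_twist D x + M10_twist D y.
Proof.
rewrite /M10_twist; case: ifP => // _.
exact: (pFrobenius_autD_comm pchar_F9 (mulrC x y)).
Qed.

Lemma M10_twistM (D x y : F9) :
  M10_twist D (x * y) = M10_twist D x * M10_twist D y.
Proof. by rewrite /M10_twist; case: ifP => // _; rewrite exprMn. Qed.

Lemma M10_twistN (D x : F9) : M10_twist D (- x) = - M10_twist D x.
Proof.
by apply/eqP; rewrite -subr_eq0 opprK -M10_twistD addNr /M10_twist; case: ifP;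
  rewrite ?expr0n.
Qed.

Lemma M10_twist_eq0 (D x : F9) : (M10_twist D x == 0) = (x == 0).
Proof. by rewrite /M10_twist; case: ifP => // _; rewrite expf_eq0. Qed.

Lemma M10_twist1 (D : F9) : M10_twist D 1 = 1.
Proof. by rewrite /M10_twist; case: ifP => // _; rewrite expr1n. Qed.

Lemma is_square_twist (D x : F9) : x != 0 ->
  is_square (M10_twist D x) = is_square x.
Proof. by move=> x0; rewrite /M10_twist; case: ifP => // _; apply: is_square_exp3. Qed.

Lemma M10_twist_comp (D E x : F9) : D != 0 -> E != 0 ->
  M10_twist E (M10_twist D x) = M10_twist (E * M10_twist D 1 * D) x.
Proof.
move=> D0 E0; rewrite M10_twist1 mulr1 /M10_twist is_squareM //.
case: (is_square D); case: (is_square E) => //=.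
by rewrite -exprM -[X in _ = X]expf_card card_F9.
Qed.

Lemma homog_pointZ (k x y : F9) : k != 0 ->
  homog_point (k * x) (k * y) = homog_point x y.
Proof.
move=> k0; rewrite /homog_point mulf_eq0 (negPf k0) /=; case: ifP => // y0.
by rewrite invfM mulrACA divff ?mul1r.
Qed.

Lemma homog_coord_point (x y : F9) : (x != 0) || (y != 0) ->
  exists2 k, k != 0 &
    x = k * (homog_coord (homog_point x y)).1 /\
    y = k * (homog_coord (homog_point x y)).2.
Proof.
rewrite /homog_point; case: (y =P 0) => [-> |/eqP y0 _] /=.
  by rewrite orbF => x0; exists x => //; rewrite mulr0 mulr1.
by exists y; rewrite ?mulr1 // mulrC divfK.
Qed.

Lemma homog_coord_neq0 (p : option F9) :
  ((homog_coord p).1 != 0) || ((homog_coord p).2 != 0).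
Proof. by case: p => [x|] /=; rewrite oner_eq0 ?orbT. Qed.

Lemma det2_neq0 (a b c d x y : F9) : a * d - b * c != 0 ->
  (x != 0) || (y != 0) -> (a * x + b * y != 0) || (c * x + d * y != 0).
Proof.
move=> D0; apply: contraLR; rewrite !negb_or !negbK => /andP[/eqP u0 /eqP v0].
have -> : (x == 0) = ((a * d - b * c) * x == 0) by rewrite mulf_eq0 (negPf D0).
have -> : (y == 0) = ((a * d - b * c) * y == 0) by rewrite mulf_eq0 (negPf D0).
have -> : (a * d - b * c) * x = d * (a * x + b * y) - b * (c * x + d * y) by ring.
have -> : (a * d - b * c) * y = a * (c * x + d * y) - c * (a * x + b * y) by ring.
by rewrite u0 v0 !mulr0 subrr eqxx.
Qed.

Lemma M10_group_set : group_set M10_set.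
Proof.
apply/group_setP; split.
  apply/M10_setP; exists 1, 0, 0, 1; rewrite mul0r mulr1 subr0 oner_eq0.
  split=> // p; rewrite perm1 /M10_twist.
  have -> : is_square 1 by apply/is_squareP; exists 1; rewrite expr1n.
  case: p => [x|]; rewrite /semilinear_frac /= /homog_point.
    by rewrite !mul1r !mul0r !addr0 !add0r oner_eq0 divr1.
  by rewrite !mul1r !mul0r !addr0 eqxx.
move=> s t /M10_setP[a [b [c [d [D0 sE]]]]] /M10_setP[a' [b' [c' [d' [E0 tE]]]]].
set D := a * d - b * c in D0 sE; set E := a' * d' - b' * c' in E0 tE.
set f := M10_twist E.
apply/M10_setP.
exists (a' * f a + b' * f c), (a' * f b + b' * f d),
       (c' * f a + d' * f c), (c' * f b + d' * f d).
have detE : (a' * f a + b' * f c) * (c' * f b + d' * f d) -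
    (a' * f b + b' * f d) * (c' * f a + d' * f c) = E * f D.
  by rewrite /D /f M10_twistD M10_twistN !M10_twistM /E; ring.
have fD0 : f D != 0 by rewrite M10_twist_eq0.
rewrite detE; split=> [|p]; first by rewrite mulf_neq0.
have twE z : M10_twist (E * f D) z = f (M10_twist D z).
  rewrite /f M10_twist_comp // M10_twist1 mulr1 /M10_twist.
  by rewrite !is_squareM // is_square_twist.
rewrite permM sE tE /semilinear_frac (surjective_pairing (homog_coord p)).
have := homog_coord_neq0 p; case: (homog_coord p) => x y /= xy0.
rewrite !twE; set X := M10_twist D x; set Y := M10_twist D y.
have XY0 : (X != 0) || (Y != 0) by rewrite !M10_twist_eq0.
have [k k0 [uE vE]] := homog_coord_point (det2_neq0 D0 XY0).
rewrite (surjective_pairing (homog_coord _)) /=.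
set q := homog_coord _ in uE vE *.
have fk0 : f k != 0 by rewrite M10_twist_eq0.
rewrite -/f -[LHS](homog_pointZ _ _ fk0); congr homog_point.
  transitivity (a' * f (a * X + b * Y) + b' * f (c * X + d * Y)).
    by rewrite uE vE /f !M10_twistM; ring.
  by rewrite /f !M10_twistD !M10_twistM; ring.
transitivity (c' * f (a * X + b * Y) + d' * f (c * X + d * Y)).
  by rewrite uE vE /f !M10_twistM; ring.
by rewrite /f !M10_twistD !M10_twistM; ring.
Qed.

Definition M10 : {group {perm (option F9)}} := Group M10_group_set.

(* Main.v *)
(* Let A6 be the index 2 subgroup of G, and for v in ZG let eps_k(v) be the   *)
(* sum of the coefficients of v at the elements of A6 of order k.  If u has   *)
(* order 6 and augmentation 1, integrality of idempotents of the rational     *)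
(* group ring and the freeness of direct summands of free modules over a      *)
(* p-group determine all eps_k(u^i) in terms of eps_2(u^3), which is 0 or 1,  *)
(* and eps_3(u), which is odd: as G has no element of order 6,                *)
(* eps_3(u^2) = eps_3(u) mod 2.  The multiplicities of the eigenvalues of u   *)
(* in two modules, of degrees 20 and 16, are nonnegative integers, which      *)
(* leaves only eps_2(u^3) = 1 and eps_2(u) = -2, and then some of these       *)
(* multiplicities vanish.  Both modules lie in the functions on pairs of      *)
(* points of the projective line over F9, and modulo 3 integral lattices in   *)
(* them have a 6-dimensional module in common.  The vanishing multiplicities  *)
(* force the trace of 1 + u^3 there to be 0 modulo 3, while the eps_k give a  *)
(* trace of -1 up to sign.                                                    *)

Require Import Defs.
From mathcomp Require Import all_boot all_order all_algebra all_fingroup.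
From mathcomp Require Import all_solvable all_field.
From mathcomp Require Import zify ring lra.

Set Implicit Arguments.
Unset Strict Implicit.
Unset Printing Implicit Defensive.

Import Order.TTheory GRing.Theory Num.Theory.
Local Open Scope ring_scope.

(** Both groups act faithfully on the projective line over F9, have no element of order 6, and
    contain A6 as the maps of square determinant; elements of A6 have order at most 5.
    [no_unit_order6_of_action] handles both at once.

    Let u have order 6, a = [ps 2 u] and e = [ps 2 (u ^+ 3)]. Left multiplication by a p-element x,
    possibly combined with right multiplication by a unit, makes the group ring modulo p a free
    module; a commuting unit of order prime to p cuts out a direct summand, on which the traces of
    the nontrivial powers sum to 0 ([trace_idem_free]). Summed over x, this is [class_sum_coprime]
    and [class_sum_order4]. With the vanishing of the coefficients at 1 ([ps_one]) and squaring
    modulo 2 ([class_sum_sqr]), everything is expressed by e, which is 0 or 1, and a, with e - a odd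
    ([ps_u]).

    By [even_rank], eigenvalue multiplicities, added up over a module and its twist by the sign, are
    natural numbers determined on A6. In degree 20 the eigenvalues 1, -1 and the primitive cube
    roots of unity occur 8 - 4a, 8 + 4a and 12 - 4e + 4a times; in degree 16 the eigenvalue 1 occurs
    (12 - 4e + 4a)/3 times. Hence e = 1, a = -2, and the last two numbers are 0.

    Let E20, E16 be the two projections, N the sum of the powers of u, and F an integral function
    fixed by E20 + E16. Then N E16 = 0 and N E20 = 3 (1 + u^3) E20, so (1 + u^3) (36 E20 F) = 12 N F
    is divisible by 3. Six such F, evaluated at six pairs of points, turn this into a statement on
    the trace of 1 + u^3 modulo 3, while the partial augmentations give -1 for it
    ([no_unit_order6_of_kernels]). *)

Local Notation rk A := (\rank A%R).

(** * Cyclic sums, ranks of powers, and ranks modulo p *)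

Lemma sum6 (R : nmodType) (F : nat -> R) :
  \sum_(i < 6) F i = F 0%N + F 1%N + F 2%N + F 3%N + F 4%N + F 5%N.
Proof. by rewrite !big_ord_recl big_ord0 /= addr0 !addrA. Qed.

Lemma mulr_cyclic_sum (R : pzRingType) (x : R) m : x ^+ m = 1 ->
  x * (\sum_(i < m) x ^+ i) = \sum_(i < m) x ^+ i.
Proof.
case: m => [|m] xm; first by rewrite big_ord0 mulr0.
rewrite mulr_sumr [RHS]big_ord_recl big_ord_recr /= -exprS xm expr0 addrC.
by congr (_ + _); apply: eq_bigr => i _; rewrite -exprS.
Qed.

Lemma sqr_cyclic_sum (R : pzRingType) (x : R) m : x ^+ m = 1 ->
  (\sum_(i < m) x ^+ i) * (\sum_(i < m) x ^+ i) = (\sum_(i < m) x ^+ i) *+ m.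
Proof.
move=> xm; have xiN i : x ^+ i * (\sum_(i < m) x ^+ i) = \sum_(i < m) x ^+ i.
  by elim: i => [|i IH]; rewrite ?mul1r // exprSr -mulrA mulr_cyclic_sum.
by rewrite mulr_suml; under eq_bigr do rewrite xiN; rewrite sumr_const card_ord.
Qed.

Lemma mxtrace_idem (F : fieldType) n (A : 'M[F]_n) :
  A *m A = A -> \tr A = (\rank A)%:R.
Proof.
move=> AA; rewrite -{1}(mulmx_base A) mxtrace_mulC.
suff -> : row_base A *m col_base A = 1%:M by rewrite mxtrace1.
apply: (row_full_inj (col_base_full A)); apply: (row_free_inj (row_base_free A)).
by rewrite /= mulmx1 -[in LHS]mulmxA -[in LHS]mulmxA [in LHS]mulmxA !mulmx_base.
Qed.

Lemma det_mxsub_rank (F : fieldType) r m n (f : 'I_r -> 'I_m) (g : 'I_r -> 'I_n)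
  (A : 'M[F]_(m, n)) : \det (mxsub f g A) != 0 -> (r <= \rank A)%N.
Proof.
rewrite -unitfE => /mxrank_unit {1}<-; rewrite mxsubrc.
apply: leq_trans (mxrankS (rowsub_sub _ _)) _.
by rewrite -mxrank_tr -[X in (_ <= X)%N]mxrank_tr trmx_mxsub mxrankS ?rowsub_sub.
Qed.

Lemma rank_mxsub_det (F : fieldType) m n (A : 'M[F]_(m, n)) :
  exists f : 'I_(\rank A) -> 'I_m, exists g : 'I_(\rank A) -> 'I_n,
  \det (mxsub f g A) != 0.
Proof.
pose B := rowsub (maxrankfun A) A.
have fB : row_full B^T.
  by rewrite /row_full mxrank_tr; have := maxrowsub_free A.
exists (maxrankfun A), (fullrankfun fB).
rewrite -unitfE -det_tr trmx_mxsub -[_ \is a _]/(_ \in unitmx).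
suff -> : mxsub (fullrankfun fB) (maxrankfun A) A^T = rowsub (fullrankfun fB) B^T.
  exact: fullrowsub_unit.
by apply/matrixP => i j; rewrite !mxE.
Qed.

(** A minor that is nonzero modulo p is a nonzero integer. *)
Lemma leq_rank_modp (p : nat) m n (A : 'M[int]_(m, n)) :
  (\rank (map_mx (intr : int -> 'F_p) A) <= \rank (map_mx (intr : int -> rat) A))%N.
Proof.
have [f [g]] := rank_mxsub_det (map_mx (intr : int -> 'F_p) A).
rewrite -map_mxsub det_map_mx => d0.
apply: (@det_mxsub_rank _ _ _ _ f g); rewrite -map_mxsub det_map_mx intr_eq0.
by apply: contraNneq d0 => ->; rewrite rmorph0.
Qed.

Lemma rank_mulX_convex (F : fieldType) n (E D : 'M[F]_n) i : GRing.comm E D ->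
  (rk (E * D ^+ i.+1) + rk (E * D ^+ i.+1) <=
   rk (E * D ^+ i) + rk (E * D ^+ i.+2))%N.
Proof.
move=> ED; have := mxrank_Frobenius D (E * D ^+ i) D; rewrite !mulmxE.
by rewrite mulrA -ED -!mulrA -exprS -!exprSr.
Qed.

(** By convexity the drops from rk (E D^i) to rk (E D^(i+1)) do not increase with i. The last one,
    down to 0, is rk (E D^(q+1)), so each of the q + 1 drops from i = 1 on is at least that. *)
Lemma rank_nilp (F : fieldType) n (E D : 'M[F]_n) q :
  GRing.comm E D -> D ^+ q.+2 = 0 ->
  (q.+1 * rk (E * D ^+ q.+1) <= rk (E * D))%N.
Proof.
move=> ED Dq; set r := rk (E * D ^+ q.+1).
have step j : (j <= q.+1)%N ->
    (r + rk (E * D ^+ (q.+2 - j)) <= rk (E * D ^+ (q.+1 - j)))%N.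
  elim: j => [|j IHj] jq; first by rewrite !subn0 Dq mulr0 mxrank0 addn0.
  have := rank_mulX_convex (q - j) ED; move: (IHj (ltnW jq)).
  have -> : (q.+2 - j = (q - j).+2)%N by lia.
  have -> : (q.+1 - j = (q - j).+1)%N by lia.
  have -> : (q.+2 - j.+1 = (q - j).+1)%N by lia.
  have -> : (q.+1 - j.+1 = (q - j))%N by lia.
  by lia.
have main j : (j <= q)%N -> (j.+1 * r <= rk (E * D ^+ (q.+1 - j)))%N.
  elim: j => [|j IHj] jq; first by rewrite mul1n subn0.
  have := step j.+1 ltac:(lia); have := IHj (ltnW jq).
  have -> : (q.+2 - j.+1 = q.+1 - j)%N by lia.
  by lia.
by have := main q (leqnn q); rewrite subSnn expr1.
Qed.

(** Multiplied by X - 1, both sides become X^(p^k) - 1, by Frobenius. *)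
Lemma expr_sub1_char (F : fieldType) (p k : nat) : p \in [pchar F] ->
  ('X - 1 : {poly F}) ^+ (p ^ k).-1 = \sum_(i < p ^ k) 'X^i.
Proof.
move=> pF; have pp := pcharf_prime pF.
have X1 : 'X - 1 != 0 :> {poly F} by rewrite -polyC1 polyXsubC_eq0.
apply: (mulfI X1); rewrite -exprS prednK ?expn_gt0 ?prime_gt0 // -subrX1.
have pP : p \in [pchar {poly F}] by rewrite pchar_poly.
elim: k => [|k IHk]; first by rewrite !expr1.
by rewrite expnSr !exprM IHk -!(pFrobenius_autE pP) pFrobenius_autB_comm ?rmorph1 //;
  apply: commr1.
Qed.

Lemma expr_sub1_charM (F : fieldType) n (X : 'M[F]_n) (p k : nat) :
  p \in [pchar F] -> (X - 1) ^+ (p ^ k).-1 = \sum_(i < p ^ k) X ^+ i.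
Proof.
case: n X => [|n] X pF; first by rewrite [LHS]flatmx0 [RHS]flatmx0.
have := congr1 (horner_mx X) (expr_sub1_char k pF).
rewrite rmorphXn rmorphB /= horner_mx_X rmorph1 => ->.
by rewrite rmorph_sum; apply: eq_bigr => i _; rewrite rmorphXn /= horner_mx_X.
Qed.

Lemma mxrankZ (F : fieldType) m n (c : F) (A : 'M_(m, n)) :
  c != 0 -> \rank (c *: A) = \rank A.
Proof. by move=> c0; rewrite eqmx_scale. Qed.

Lemma map_mxM_int (R : pzRingType) n (A B : 'M[int]_n) :
  map_mx (intr : int -> R) (A * B) = map_mx intr A * map_mx intr B.
Proof. exact: map_mxM. Qed.

Lemma map_mxX_int (R : pzRingType) n (A : 'M[int]_n) i :
  map_mx (intr : int -> R) (A ^+ i) = map_mx intr A ^+ i.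
Proof.
elim: i => [|i IHi]; last by rewrite !exprS map_mxM_int IHi.
by rewrite !expr0; exact: map_mx1.
Qed.

Lemma map_mx_sum_int (R : pzRingType) m n I (r : seq I) (F : I -> 'M[int]_(m, n)) :
  map_mx (intr : int -> R) (\sum_(i <- r) F i) = \sum_(i <- r) map_mx intr (F i).
Proof. exact: raddf_sum. Qed.

Lemma trace_map_int (R : pzRingType) n (A : 'M[int]_n) :
  \tr (map_mx (intr : int -> R) A) = (\tr A)%:~R.
Proof. exact: trace_map_mx. Qed.

Lemma scalemx_mull (R : comPzRingType) n (a : R) (A B : 'M[R]_n) :
  (a *: A) * B = a *: (A * B).
Proof. by rewrite -!mulmxE scalemxAl. Qed.

Lemma scalemx_mulr (R : comPzRingType) n (a : R) (A B : 'M[R]_n) :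
  A * (a *: B) = a *: (A * B).
Proof. by rewrite -!mulmxE scalemxAr. Qed.

Definition scalemxM := (scalemx_mull, scalemx_mulr).

(** * Direct summands of free modules over a cyclic p-group *)

Section OneIdempotent.
Variables (p k n m : nat) (X e : 'M[int]_n).
Hypotheses (p_pr : prime p) (k_gt0 : (0 < k)%N) (m_gt0 : (0 < m)%N).
Hypotheses (Xq : X ^+ (p ^ k) = 1) (Xe : GRing.comm e X) (ee : e * e = e *+ m).
Let q := (p ^ k)%N.
Let Nm := \sum_(i < q) X ^+ i.
Let modp (A : 'M[int]_n) := map_mx (intr : int -> 'F_p) A.
Let ratm (A : 'M[int]_n) := map_mx (intr : int -> rat) A.

Let q_gt1 : (1 < q)%N. Proof. by rewrite -(exp1n k) ltn_exp2r ?prime_gt1. Qed.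
Let q_neq0 : q%:R != 0 :> rat. Proof. by rewrite pnatr_eq0; lia. Qed.
Let m_neq0 : m%:R != 0 :> rat. Proof. by rewrite pnatr_eq0; lia. Qed.

Let XNm : X * Nm = Nm.
Proof. exact: mulr_cyclic_sum. Qed.

Let NmNm : Nm * Nm = Nm *+ q.
Proof. exact: sqr_cyclic_sum. Qed.

Let eNm : GRing.comm e Nm.
Proof. by apply: commr_sum => i _; apply: commrX. Qed.

Let eps := m%:R^-1 *: ratm e.
Let nu := q%:R^-1 *: ratm Nm.

Let eps_idem : eps * eps = eps.
Proof.
rewrite /eps !scalemxM scalerA -map_mxM_int ee raddfMn /=.
by rewrite -scaler_nat scalerA mulrAC mulfK // mulVf ?scale1r // divff // mul1r.
Qed.

Let nu_idem : nu * nu = nu.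
Proof.
rewrite /nu !scalemxM scalerA -map_mxM_int NmNm raddfMn /=.
by rewrite -scaler_nat scalerA mulfVK // scale1r.
Qed.

Let eps_nu : GRing.comm eps nu.
Proof.
rewrite /GRing.comm /eps /nu !scalemxM !scalerA -!map_mxM_int.
by rewrite eNm mulrC.
Qed.

Let epsnu_idem : (eps * nu) * (eps * nu) = eps * nu.
Proof. by rewrite mulrA -(mulrA eps) -eps_nu mulrA eps_idem -mulrA nu_idem. Qed.

(** Let s be the rank of e [Nm] modulo p. Reduction modulo p can only lower ranks, so s <= rk (eps
    nu). Modulo p, [Nm] is (X - 1)^(q-1), whence (q-1) s <= rk (e (X - 1)) <= rk (eps - eps nu).
    These add up to q s <= rk e; equality forces rk e = q rk (eps nu), and ranks of idempotents are
    traces. *)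
Lemma rank_norm_le : (q * rk (modp (e * Nm)) <= rk (ratm e))%N /\
  ((rk (ratm e) <= q * rk (modp (e * Nm)))%N ->
   \sum_(i < q) \tr (e * X ^+ i) = \tr e).
Proof.
set s := rk (modp (e * Nm)); set R := rk (ratm e).
have R_eps : rk eps = R by rewrite mxrankZ ?invr_neq0.
set r := rk (eps * nu).
have sr : (s <= r)%N.
  rewrite /r /eps /nu !scalemxM scalerA mxrankZ; last first.
    by rewrite mulf_neq0 ?invr_neq0.
  by rewrite -map_mxM_int leq_rank_modp.
have compl_rank : (rk (eps - eps * nu) + r)%N = R.
  apply/eqP; rewrite -R_eps -(eqr_nat rat) natrD -!mxtrace_idem ?mulmxE //.
    by rewrite raddfB /= subrK.
  rewrite mulrBl !mulrBr epsnu_idem eps_idem mulrA eps_idem.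
  by rewrite -mulrA -eps_nu mulrA eps_idem subrr subr0.
have eX_rank : (rk (modp (e * (X - 1))) <= rk (eps - eps * nu))%N.
  apply: leq_trans (leq_rank_modp _ _) _.
  rewrite -(@mxrankZ _ _ _ m%:R^-1) ?invr_neq0 // map_mxM_int -scalemx_mull.
  have -> : eps * ratm (X - 1) = (eps - eps * nu) * ratm (X - 1).
    rewrite mulrBl -mulrA /nu (scalemx_mull _ (ratm Nm)) -map_mxM_int.
    have -> : Nm * (X - 1) = 0.
      have /commr_sym NmX : GRing.comm X Nm by apply: commr_sum => i _; apply: commrX.
      by rewrite mulrBr mulr1 NmX XNm subrr.
    by rewrite raddf0 scaler0 mulr0 subr0.
  exact: mxrankM_maxl.
have pF : p \in [pchar 'F_p] by rewrite pchar_Fp.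
have nilp : ((q.-1) * s <= rk (modp (e * (X - 1))))%N.
  have NmE : modp Nm = (modp X - 1) ^+ q.-1.
    rewrite expr_sub1_charM // /modp map_mx_sum_int.
    by apply: eq_bigr => i _; rewrite map_mxX_int.
  have -> : modp (e * (X - 1)) = modp e * (modp X - 1).
    by rewrite /modp map_mxM_int raddfB /= map_mx1.
  rewrite /s /modp map_mxM_int -!/(modp _) NmE.
  case: q q_gt1 NmE (Xq : X ^+ q = 1) => [|[|q']] // _ NmE Xq'.
  apply: rank_nilp.
    apply: commrB; last exact: commr1.
    by rewrite /GRing.comm /modp -!map_mxM_int Xe.
  rewrite exprS -NmE.
  have -> : modp X - 1 = modp (X - 1) by rewrite /modp raddfB /= map_mx1.
  by rewrite -map_mxM_int mulrBl mul1r XNm subrr raddf0.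
split; first by nia.
move=> Rle; have {}Rle : R = (q * r)%N by nia.
apply: (@intr_inj rat).
have trE : \tr (eps * nu) * q%:R = \tr eps.
  by rewrite !mxtrace_idem ?mulmxE // R_eps Rle natrM mulrC.
move: trE; rewrite /eps /nu !scalemxM scalerA -map_mxM_int !mxtraceZ !trace_map_int.
rewrite mulrAC mulrVK ?unitfE // => /(mulfI (invr_neq0 m_neq0)) <-.
by rewrite /Nm mulr_sumr (raddf_sum (@mxtrace _ _)).
Qed.
End OneIdempotent.

(* Over F_p, an e-stable splitting of a free module for the group generated   *)
(* by X is a splitting into free modules; ranks over Q can only be larger, so *)
(* both summands are also free over Q.                                        *)
Lemma trace_idem_free (p k n m : nat) (X e : 'M[int]_n) :
    prime p -> (0 < k)%N -> ~~ (p %| m)%N ->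
    X ^+ (p ^ k) = 1 -> GRing.comm e X -> e * e = e *+ m ->
    (n <= p ^ k * rk (map_mx (intr : int -> 'F_p) (\sum_(i < p ^ k) X ^+ i)))%N ->
  \sum_(i < p ^ k) \tr (e * X ^+ i) = \tr e.
Proof.
move=> p_pr k0 pm Xq Xe ee free.
have m0 : (0 < m)%N by case: m pm {ee} => //; rewrite dvdn0.
(* The complementary summand: by freeness the two bounds from [rank_norm_le] add up to n, so both
   are equalities. *)
pose e' : 'M[int]_n := m%:R - e.
have Xe' : GRing.comm e' X.
  by apply: commr_sym; apply: commrB; [apply: commr_nat | apply: commr_sym].
have ee' : e' * e' = e' *+ m.
  have e'e : e' * e = 0 by rewrite /e' mulrBl ee mulr_natl subrr.
  by rewrite {2}/e' mulrBr e'e subr0 mulr_natr.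
have [le1 ->] := rank_norm_le p_pr k0 m0 Xq Xe ee; first by [].
have [le2 _] := rank_norm_le p_pr k0 m0 Xq Xe' ee'.
set Nm := \sum_(i < p ^ k) X ^+ i in free le1 le2 *.
have sum_le : (rk (map_mx (intr : int -> 'F_p) Nm) <=
   rk (map_mx (intr : int -> 'F_p) (e * Nm)) +
   rk (map_mx (intr : int -> 'F_p) (e' * Nm)))%N.
  rewrite -(@mxrankZ _ _ _ m%:R); last first.
    by rewrite -(dvdn_pcharf (pchar_Fp p_pr)).
  apply: leq_trans (mxrank_add _ _); rewrite -raddfD -mulrDl addrC subrK.
  by rewrite mulr_natl raddfMn scaler_nat.
have sum_n : (rk (map_mx (intr : int -> rat) e) +
              rk (map_mx (intr : int -> rat) e'))%N = n.
  have idem (f : 'M[int]_n) : f * f = f *+ m -> let F := map_mx (intr : int -> rat) f in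
      (\tr F = m%:R * (rk F)%:R).
    move=> ff F; have mr0 : m%:R != 0 :> rat by rewrite pnatr_eq0; lia.
    rewrite -(@mxrankZ _ _ _ m%:R^-1 F) ?invr_neq0 // -mxtrace_idem.
      by rewrite mxtraceZ mulVKf.
    rewrite mulmxE !scalemxM scalerA -map_mxM_int ff raddfMn /=.
    by rewrite -scaler_nat scalerA mulfVK.
  apply/eqP; rewrite -(eqr_nat rat) natrD.
  have mr0 : m%:R != 0 :> rat by rewrite pnatr_eq0; lia.
  rewrite -(inj_eq (mulfI mr0)) mulrDr -!idem // /e' raddfB -raddfD /= addrC subrK.
  rewrite trace_map_int (raddfMn (@mxtrace _ n)) /= (_ : \tr _ = n%:R); last exact: mxtrace1.
  by rewrite rmorphMn /= rmorph_nat mulr_natl.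
by nia.
Qed.

(* A preserves the positive definite form S = sum of the A^i (A^i)^T, so A^-1 *)
(* is conjugate to A^T.                                                       *)
Lemma mxtrace_finite_order_inv (F : realFieldType) n (A B : 'M[F]_n) N :
  (0 < N)%N -> A ^+ N = 1 -> A * B = 1 -> B * A = 1 -> \tr B = \tr A.
Proof.
case: N => // N _ AN AB BA.
pose S := \sum_(i < N.+1) A ^+ i *m (A ^+ i)^T.
have AS : A *m S *m A^T = S.
  rewrite /S mulmx_sumr mulmx_suml [RHS]big_ord_recl big_ord_recr /= addrC.
  rewrite -mulmxA -[in LHS]mulmxA -trmx_mul !mulmxE mulrA -exprS AN.
  congr (_ + _); apply: eq_bigr => i _.
  by rewrite exprS -!mulmxE trmx_mul !mulmxA.
have dotE (w : 'rV[F]_n) : (w *m w^T) 0 0 = \sum_j w 0 j ^+ 2.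
  by rewrite mxE; apply: eq_bigr => j _; rewrite mxE expr2.
(* S is positive definite: the term i = 0 of v S v^T is already the squared length of v. *)
have Su : S \in unitmx.
  rewrite -row_free_unit; apply: inj_row_free => v vS.
  have : (v *m S *m v^T) 0 0 = 0 by rewrite vS mul0mx mxE.
  rewrite /S mulmx_sumr mulmx_suml summxE big_ord_recl => sum0.
  have sq i : 0 <= (v *m (A ^+ i *m (A ^+ i)^T) *m v^T) 0 0.
    rewrite mulmxA -(mulmxA (v *m _)) -trmx_mul dotE.
    by apply: sumr_ge0 => j _; exact: sqr_ge0.
  move/eqP: sum0; rewrite paddr_eq0 ?sq ?sumr_ge0 // => /andP[/eqP + _].
  have -> : A ^+ (ord0 : 'I_N.+1) *m (A ^+ (ord0 : 'I_N.+1))^T = 1%:M.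
    by rewrite expr0; rewrite -[LHS]/(1%:M *m 1%:M^T) trmx1 mulmx1.
  rewrite mulmx1 dotE.
  move=> /psumr_eq0P v0; apply/rowP => j; rewrite [RHS]mxE; apply/eqP.
  by rewrite -sqrf_eq0; apply/eqP; apply: v0 => // k _; exact: sqr_ge0.
have : A *m S = S *m B^T.
  by rewrite -{2}AS -[RHS]mulmxA -trmx_mul mulmxE BA -[RHS]/(A *m S *m 1%:M^T) trmx1 mulmx1.
move/(congr1 (mulmx^~ (invmx S)))/(congr1 mxtrace).
by rewrite mulmxK // mxtrace_mulC mulmxA mulVmx // mul1mx mxtrace_tr => ->.
Qed.

(** * Matrices of kernels and maps, and the regular representation *)

Section KernelMatrices.
Variables (R : comPzRingType) (T : finType).
Implicit Types (k l : T -> T -> R) (f g : T -> T).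

Definition kmx k : 'M[R]_#|T| := \matrix_(i, j) k (enum_val i) (enum_val j).

Definition fmx f := kmx (fun x y => (f x == y)%:R).

Lemma eq_kmx k l : k =2 l -> kmx k = kmx l.
Proof. by move=> kl; apply/matrixP => i j; rewrite !mxE kl. Qed.

Lemma kmxM k l : kmx k * kmx l = kmx (fun x z => \sum_y k x y * l y z).
Proof.
apply/matrixP => i j; rewrite -mulmxE !mxE (big_enum_val (A := T)) /=.
by apply: eq_bigr => m _; rewrite !mxE.
Qed.

Lemma kmx1 : kmx (fun x y => (x == y)%:R) = 1.
Proof. by apply/matrixP => i j; rewrite !mxE (inj_eq enum_val_inj). Qed.

Lemma mxtrace_kmx k : \tr (kmx k) = \sum_x k x x.
Proof.
rewrite (big_enum_val (A := T)) /mxtrace /=; apply: eq_bigr => i _.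
by rewrite mxE.
Qed.

Lemma fmx_kmx f k : fmx f * kmx k = kmx (fun x y => k (f x) y).
Proof.
rewrite kmxM; apply: eq_kmx => x z.
rewrite (bigD1 (f x)) //= eqxx mul1r big1 ?addr0 // => y yf.
by rewrite eq_sym (negPf yf) mul0r.
Qed.

Lemma kmx_fmx f g k : cancel f g -> cancel g f ->
  kmx k * fmx f = kmx (fun x y => k x (g y)).
Proof.
move=> fg gf; rewrite kmxM; apply: eq_kmx => x z.
rewrite (bigD1 (g z)) //= gf eqxx mulr1 big1 ?addr0 // => y yf.
by rewrite (canF_eq fg) (negPf yf) mulr0.
Qed.

Lemma fmxM f g : fmx f * fmx g = fmx (g \o f).
Proof. by rewrite fmx_kmx. Qed.

Lemma fmx_id f : f =1 id -> fmx f = 1.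
Proof. by move=> fid; rewrite -kmx1; apply: eq_kmx => x y; rewrite fid. Qed.

End KernelMatrices.

Lemma map_kmx (T : finType) (R : comPzRingType) (k : T -> T -> int) :
  map_mx (intr : int -> R) (kmx k) = kmx (fun x y => (k x y)%:~R).
Proof. by apply/matrixP => i j; rewrite !mxE. Qed.

Lemma map_fmx (T : finType) (R : comPzRingType) (f : T -> T) :
  map_mx (intr : int -> R) (fmx _ f) = fmx R f.
Proof. by rewrite map_kmx; apply: eq_kmx => x y; case: (_ == _). Qed.

Section GroupRingCoef.
Variables (R : nzRingType) (gT : finGroupType).
Implicit Types u v : group_ring R gT.

Lemma gr_coefM u v g : coef (u * v) g = \sum_h coef u h * coef v (h^-1 * g)%g.
Proof. by rewrite {1}/coef ffunE. Qed.

Lemma gr_coef1 g : coef (1 : group_ring R gT) g = (g == 1%g)%:R.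
Proof. by rewrite /coef ffunE. Qed.

Lemma gr_coefD u v g : coef (u + v) g = coef u g + coef v g.
Proof. by rewrite /coef ffunE. Qed.

Lemma gr_coefB u v g : coef (u - v) g = coef u g - coef v g.
Proof. by rewrite /coef !ffunE. Qed.

Lemma gr_coef_sum I (r : seq I) (F : I -> group_ring R gT) g :
  coef (\sum_(i <- r) F i) g = \sum_(i <- r) coef (F i) g.
Proof.
elim/big_rec2: _ => [|i y z _ <-]; last exact: gr_coefD.
by rewrite /coef ffunE.
Qed.

End GroupRingCoef.

Section Representations.
Variables (R : comNzRingType) (gT : finGroupType) (n : nat) (P : gT -> 'M[R]_n).

Definition rep (v : group_ring int gT) : 'M[R]_n :=
  \sum_g (coef v g)%:~R *: P g.

Lemma repD v w : rep (v + w) = rep v + rep w.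
Proof.
rewrite -big_split; apply: eq_bigr => g _.
by rewrite gr_coefD rmorphD /= scalerDl.
Qed.

Lemma repN v : rep (- v) = - rep v.
Proof.
rewrite /rep -sumrN; apply: eq_bigr => g _.
by rewrite /coef ffunE rmorphN scaleNr.
Qed.

Lemma repMn v i : rep (v *+ i) = rep v *+ i.
Proof.
elim: i => [|i IHi]; last by rewrite !mulrS repD IHi.
by rewrite !mulr0n /rep big1 // => g _; rewrite /coef ffunE scale0r.
Qed.

Lemma trace_rep A v : \tr (A * rep v) = \sum_g (coef v g)%:~R * \tr (A * P g).
Proof.
rewrite mulr_sumr (raddf_sum (@mxtrace _ _)) /=; apply: eq_bigr => g _.
by rewrite scalemxM mxtraceZ.
Qed.

Lemma commr_rep A v : (forall g, GRing.comm A (P g)) -> GRing.comm A (rep v).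
Proof.
move=> AP; apply: commr_sum => g _.
by rewrite /GRing.comm !scalemxM AP.
Qed.

Hypotheses (P1 : P 1%g = 1) (PM : forall g h, P (g * h)%g = P g * P h).

Lemma rep1 : rep 1 = 1.
Proof.
rewrite /rep (bigD1 1%g) //= big1 ?addr0 => [|g /negPf g1].
  by rewrite gr_coef1 eqxx P1 scale1r.
by rewrite gr_coef1 g1 scale0r.
Qed.

Lemma repM v w : rep (v * w) = rep v * rep w.
Proof.
rewrite /rep mulr_suml.
under [RHS]eq_bigr => h _ do
  rewrite mulr_sumr (reindex_inj (mulgI h^-1%g)) /=.
rewrite [RHS]exchange_big; apply: eq_bigr => g _.
rewrite gr_coefM rmorph_sum scaler_suml; apply: eq_bigr => h _.
by rewrite rmorphM /= !scalemxM scalerA -PM mulKVg.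
Qed.

Lemma repX v i : rep (v ^+ i) = rep v ^+ i.
Proof. by elim: i => [|i IHi]; rewrite ?expr0 ?rep1 // !exprS repM IHi. Qed.

End Representations.

Section Regular.
Variable gT : finGroupType.
Implicit Types (R : comPzRingType) (v w : group_ring int gT) (x y g : gT).

Definition rmul R g : 'M[R]_#|gT| := fmx R (fun y => y * g)%g.
(** Products of [fmx] compose maps from left to right, so the inverse is needed to make [lmul]
    multiplicative. *)
Definition lmul R x : 'M[R]_#|gT| := fmx R (fun y => x^-1 * y)%g.

Lemma rmul1 R : rmul R 1 = 1.
Proof. by apply: fmx_id => y; rewrite mulg1. Qed.

Lemma rmulM R g h : rmul R (g * h) = rmul R g * rmul R h.
Proof. by rewrite /rmul fmxM; apply: eq_kmx => x y /=; rewrite mulgA. Qed.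

Lemma lmul1 R : lmul R 1 = 1.
Proof. by apply: fmx_id => y; rewrite invg1 mul1g. Qed.

Lemma lmulM R g h : lmul R (g * h) = lmul R g * lmul R h.
Proof. by rewrite /lmul fmxM; apply: eq_kmx => x y /=; rewrite invMg mulgA. Qed.

Lemma lmulX R x i : lmul R (x ^+ i) = lmul R x ^+ i.
Proof. by elim: i => [|i IHi]; rewrite ?lmul1 // expgS exprS lmulM IHi. Qed.

Lemma lmul_rmul R x g : GRing.comm (lmul R x) (rmul R g).
Proof. by rewrite /GRing.comm !fmxM; apply: eq_kmx => y z /=; rewrite mulgA. Qed.

Lemma mxtrace_lmul_rmul R x g :
  \tr (lmul R x * rmul R g) = \sum_y (g == x ^ y)%g%:R.
Proof.
rewrite fmxM mxtrace_kmx; apply: eq_bigr => y _ /=.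
by rewrite -(inj_eq (mulgI (x^-1 * y)^-1%g)) mulKg invMg invgK conjgE mulgA.
Qed.

Definition reg v : 'M[int]_#|gT| := rep (rmul int) v.

Lemma mxtrace_reg x v : \tr (lmul int x * reg v) = \sum_y coef v (x ^ y)%g.
Proof.
rewrite trace_rep.
under eq_bigr => g _ do rewrite mxtrace_lmul_rmul intz mulr_sumr.
rewrite exchange_big; apply: eq_bigr => y _ /=.
rewrite (bigD1 (x ^ y)%g) //= eqxx mulr1 big1 ?addr0 // => g /negPf ->.
by rewrite mulr0.
Qed.

End Regular.

(* The projection S onto the span of a transversal of <[x]> splits the norm:  *)
(* its conjugates by the powers of x sum to 1.                                *)
Section Transversal.
Variables (F : fieldType) (gT : finGroupType) (x : gT).

Let D := [pred y : gT | y == repr (<[x]> :* y)%g].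
Let S : 'M[F]_#|gT| := kmx (fun y z => ((y == z) && D y)%:R).

Let DX i y : D (x ^+ i * y)%g = (x ^+ i * y == repr (<[x]> :* y))%g.
Proof. by rewrite /D /= rcosetM rcoset_id ?mem_cycle. Qed.

Let S_lmul_S (i : 'I_(#[x]%g)) :
  S * lmul F (x ^+ i)%g * S = if i == 0%N :> nat then S else 0.
Proof.
have canX : cancel (fun y => x ^- i * y)%g (fun y => x ^+ i * y)%g.
  by move=> y; rewrite mulKVg.
have canX' : cancel (fun y => x ^+ i * y)%g (fun y => x ^- i * y)%g.
  by move=> y; rewrite mulKg.
rewrite (kmx_fmx _ canX canX') kmxM.
have -> : (if i == 0%N :> nat then S else 0) =
    kmx (fun y z => ((y == z) && D y && (i == 0%N :> nat))%:R).
  case: eqP => _; apply/matrixP => a b; rewrite !mxE ?andbT //.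
  by rewrite andbF.
apply: eq_kmx => y z.
rewrite (bigD1 z) //= eqxx /= big1 ?addr0 => [|t /negPf tz]; last first.
  by rewrite tz mulr0.
rewrite -natrM mulnb -/D; congr (nat_of_bool _)%:R.
case: (i =P 0%N :> nat) => [->|/eqP i0]; rewrite ?andbT ?andbF.
  by rewrite expg0 mul1g; case: eqP => //= ->; rewrite andbb.
apply/negP => /andP[/andP[/eqP yE Dy] /eqP Dz].
have : D (x ^+ i * z)%g by rewrite -yE.
rewrite DX -Dz -[X in _ == X]mul1g (inj_eq (mulIg z)).
by rewrite -order_dvdn gtnNdvd // lt0n.
Qed.

Let sum_conj_S :
  \sum_(i < #[x]%g) lmul F (x ^+ i)%g * S * lmul F (x ^- i)%g = 1.
Proof.
under eq_bigr => i _ do [rewrite fmx_kmx (kmx_fmx _ (g := (fun y => x ^- i * y)%g));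
  [|by move=> y /=; rewrite invgK mulKg|by move=> y /=; rewrite invgK mulKVg]].
apply/matrixP => a b; rewrite summxE -kmx1 mxE.
set y := enum_val a; set z := enum_val b.
under eq_bigr => i _ do rewrite mxE (inj_eq (mulgI _)) -/y -/z.
case: (y =P z) => _ /=; last by rewrite big1.
have /rcosetP[c cx rE] := mem_repr_rcoset <[x]>%G y.
have [m mx cE] : {m | (m < #[x]%g)%N & (c^-1 = x ^+ m)%g}.
  by apply: cyclePmin; rewrite groupV.
have Di (i : nat) : (x ^- i * y == repr (<[x]> :* (x ^- i * y)))%g
    = (i == m %[mod #[x]%g]).
  rewrite rcosetM rcoset_id ?groupV ?mem_cycle // rE (inj_eq (mulIg y)).
  by rewrite -[c]invgK cE (inj_eq invg_inj) eq_expg_mod_order.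
under eq_bigr => i _ do rewrite Di.
rewrite (bigD1 (Ordinal mx)) //=  eqxx big1 ?addr0 // => i im.
rewrite !modn_small //; case: eqP => // iE.
by case/eqP: im; apply: val_inj.
Qed.

(** S N S = S gives rk S <= rk N, and 1 is a sum of #[x] matrices of rank at most rk S. Thus the
    regular module is free over <[x]>, in the form used by [trace_idem_free]. *)
Lemma rank_lmul_norm :
  (#|gT| <= #[x]%g * rk (\sum_(i < #[x]%g) lmul F (x ^+ i)%g))%N.
Proof.
set Nm := \sum_(i < _) _.
have SNmS : S * Nm * S = S.
  rewrite /Nm mulr_sumr mulr_suml (bigD1 (Ordinal (order_gt0 x))) //= big1.
    by rewrite (S_lmul_S (Ordinal (order_gt0 x))) /= addr0.
  by move=> i i0; rewrite S_lmul_S; case: eqP => // iE; case/eqP: i0; apply: val_inj.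
have rS : (rk S <= rk Nm)%N.
  rewrite -{1}SNmS; apply: leq_trans (mxrankM_maxl _ _) _.
  exact: mxrankM_maxr.
rewrite -{1}(@mxrank1 F #|gT|) -[1%:M]/(1 : 'M_#|gT|) -sum_conj_S.
apply: leq_trans (_ : #[x]%g * rk S <= _)%N; last by rewrite leq_mul2l rS orbT.
rewrite -[X in (X * _)%N]card_ord -sum_nat_const.
elim/big_rec2: _ => [|i r A _ IH]; first by rewrite mxrank0.
apply: leq_trans (mxrank_add _ _) _; apply: leq_add => //.
by apply: leq_trans (mxrankM_maxl _ _) _; exact: mxrankM_maxr.
Qed.

End Transversal.

(** A module free over the subgroup of order 2 is free over the cyclic group of order 4. With D = X
    - 1, the norms of X^2 and X are D^2 and D^3, and D^4 = 0; convexity of the ranks of D^i turns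
    n/2 <= rk D^2 into n/4 <= rk D^3. *)
Lemma rank_norm_char2 (F : fieldType) n (X : 'M[F]_n) :
  2%N \in [pchar F] -> X ^+ 4 = 1 ->
  (n <= 2 * rk (\sum_(i < 2) (X ^+ 2) ^+ i))%N ->
  (n <= 4 * rk (\sum_(i < 4) X ^+ i))%N.
Proof.
move=> c2 X4; pose D := X - 1.
have cX : forall e : nat, \sum_(i < 2 ^ e) X ^+ i = D ^+ (2 ^ e).-1.
  by move=> e; rewrite (expr_sub1_charM _ e c2).
have D4 : D ^+ 4 = 0.
  by rewrite exprS -(cX 2%N) -subrX1 X4 subrr.
have D2 : D ^+ 2 = \sum_(i < 2) (X ^+ 2) ^+ i.
  have := expr_sub1_charM (X ^+ 2) 1 c2; rewrite expr1 => <-.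
  by rewrite (subrX1 X 2) (cX 1%N).
rewrite -D2 (cX 2%N) => r2.
have := rank_mulX_convex 0 (commr_sym (commr1 D)).
have := rank_mulX_convex 1 (commr_sym (commr1 D)).
have := rank_mulX_convex 2 (commr_sym (commr1 D)).
rewrite !mul1r D4 mxrank0 expr0 -[\rank 1]/(\rank (1%:M : 'M[F]_n)) mxrank1.
by move: r2; rewrite -[(2 ^ 2).-1]/3%N; lia.
Qed.

(** * Class sums of torsion units *)

Section ClassSums.
Variable gT : finGroupType.
Implicit Types (v w : group_ring int gT) (x y g : gT) (B : {set gT}).

Definition class_sum B v : int := \sum_(x in B) coef v x.

Lemma class_sumD B v w : class_sum B (v + w) = class_sum B v + class_sum B w.
Proof. by rewrite -big_split; apply: eq_bigr => x _; exact: gr_coefD. Qed.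

Lemma class_sum_sum B I (r : seq I) (F : I -> group_ring int gT) :
  class_sum B (\sum_(i <- r) F i) = \sum_(i <- r) class_sum B (F i).
Proof.
by rewrite exchange_big; apply: eq_bigr => x _; exact: gr_coef_sum.
Qed.

Definition conj_closed B := forall x y, ((x ^ y)%g \in B) = (x \in B).

Lemma sum_mxtrace_reg B v : conj_closed B ->
  \sum_(x in B) \tr (lmul int x * reg v) = class_sum B v *+ #|gT|.
Proof.
move=> Bcl; under eq_bigr => x _ do rewrite mxtrace_reg.
rewrite exchange_big /= -sumr_const; apply: eq_bigr => y _.
rewrite [RHS](reindex_inj (conjg_inj y)) /=.
by apply: eq_bigl => x; rewrite Bcl.
Qed.

Lemma reg1 : reg (1 : group_ring int gT) = 1.
Proof. exact/rep1/rmul1. Qed.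

Lemma regM v w : reg (v * w) = reg v * reg w.
Proof. exact/repM/rmulM. Qed.

Lemma regX v i : reg (v ^+ i) = reg v ^+ i.
Proof. by apply: repX; [exact: rmul1 | exact: rmulM]. Qed.

Lemma lmul_reg x v : GRing.comm (lmul int x) (reg v).
Proof. by apply: commr_rep => g; exact: lmul_rmul. Qed.

(** The sum of the powers of v is m times an idempotent, with m prime to p, so it cuts a direct
    summand out of the free module on which X acts by x on the left and w on the right. *)
Lemma reg_free_trace (p k m : nat) x v w :
    prime p -> (0 < k)%N -> ~~ (p %| m)%N -> v ^+ m = 1 -> GRing.comm v w ->
    (lmul int x * reg w) ^+ (p ^ k) = 1 ->
    (#|gT| <= p ^ k * rk (\sum_(i < p ^ k)
       map_mx (intr : int -> 'F_p) (lmul int x * reg w) ^+ i))%N ->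
  \sum_(i < (p ^ k).-1)
    \tr (lmul int (x ^+ i.+1)%g * reg ((\sum_(j < m) v ^+ j) * w ^+ i.+1)) = 0.
Proof.
move=> p_pr k0 pm vm vw Xq free.
set s := \sum_(j < m) v ^+ j; set X := lmul int x * reg w in Xq free.
have ss : s * s = s *+ m by exact: sqr_cyclic_sum.
have sw : GRing.comm s w.
  by apply: commr_sym; apply: commr_sum => i _; apply: commrX; exact: commr_sym.
have eX : GRing.comm (reg s) X.
  apply: commrM; first by apply: commr_sym; exact: lmul_reg.
  by rewrite /GRing.comm -!regM sw.
have ee : reg s * reg s = reg s *+ m by rewrite -regM ss /reg repMn.
have Xi i : \tr (reg s * X ^+ i) = \tr (lmul int (x ^+ i)%g * reg (s * w ^+ i)).
  rewrite regM regX lmulX /X exprMn_comm; last exact: lmul_reg.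
  by rewrite !mulrA -lmulX lmul_reg.
have := trace_idem_free p_pr k0 pm Xq eX ee.
rewrite map_mx_sum_int.
under eq_bigr => i _ do rewrite map_mxX_int.
move=> /(_ free) tr_sum.
have q0 : (p ^ k)%N = (p ^ k).-1.+1 by rewrite prednK ?expn_gt0 ?prime_gt0.
rewrite q0 in tr_sum; move: tr_sum.
rewrite big_ord_recl expr0 mulr1 -[RHS]addr0 => /addrI tr0.
rewrite -[RHS]tr0; apply: eq_bigr => i _; by rewrite Xi.
Qed.

Lemma sum_expg_prime (p i : nat) B (f : gT -> int) : prime p -> (0 < i < p)%N ->
    (forall x, x \in B -> #[x]%g = p) -> (forall x, x \in B -> (x ^+ i)%g \in B) ->
  \sum_(x in B) f (x ^+ i)%g = \sum_(x in B) f x.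
Proof.
move=> p_pr ip ordB Bi.
have injB : {in B &, injective (fun x => x ^+ i)%g}.
  move=> x y xB yB /= xy; have cop : coprime p i.
    by rewrite prime_coprime //; apply/negP => /dvdn_leq; lia.
  have K z : z \in B -> ((z ^+ i) ^+ (egcdn i p).1)%g = z.
    move=> zB; have := @expgK _ <[z]>%G i; rewrite /= -orderE ordB // => /(_ cop).
    by move=> /(_ z (cycle_id z)); rewrite /expg_invn -orderE ordB.
  by rewrite -(K x xB) -(K y yB) xy.
rewrite -(big_imset f injB) /=; apply: eq_bigl => x.
suff /eqP -> : [set (y ^+ i)%g | y in B] == B by [].
rewrite eqEcard card_in_imset // leqnn andbT.
by apply/subsetP => _ /imsetP[y yB ->]; exact: Bi.
Qed.

(** Take w = 1. When x runs over B, each of the p - 1 nontrivial powers of x contributes the same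
    multiple of the class sum. *)
Lemma class_sum_coprime (p m : nat) B v : prime p -> ~~ (p %| m)%N -> v ^+ m = 1 ->
    conj_closed B -> (forall x, x \in B -> #[x]%g = p) ->
    (forall x i, x \in B -> (0 < i < p)%N -> (x ^+ i)%g \in B) ->
  class_sum B (\sum_(j < m) v ^+ j) = 0.
Proof.
move=> p_pr pm vm Bcl ordB BX; set s := \sum_(j < m) v ^+ j.
have free x : x \in B ->
    \sum_(i < p.-1) \tr (lmul int (x ^+ i.+1)%g * reg s) = 0.
  move=> xB; have := @reg_free_trace p 1 m x v 1 p_pr isT pm vm (commr1 v).
  rewrite reg1 mulr1 expn1 -lmulX -{1}(ordB x xB) expg_order lmul1 => /(_ erefl).
  have -> : \sum_(i < p) map_mx (intr : int -> 'F_p) (lmul int x) ^+ i =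
            \sum_(i < #[x]%g) lmul 'F_p (x ^+ i)%g.
    by rewrite ordB //; apply: eq_bigr => i _; rewrite map_fmx -lmulX.
  rewrite -{1}(ordB x xB) => /(_ (rank_lmul_norm _ x)) tr0.
  rewrite -[RHS]tr0; apply: eq_bigr => i _; by rewrite expr1n mulr1.
have: \sum_(x in B) \sum_(i < p.-1) \tr (lmul int (x ^+ i.+1)%g * reg s) = 0.
  by rewrite big1 // => x xB; exact: free.
rewrite exchange_big /=.
under eq_bigr => i _.
  rewrite (sum_expg_prime (p := p) (fun x => \tr (lmul int x * reg s))) //; first over.
  - by have := ltn_ord i; have := prime_gt1 p_pr; lia.
  - by move=> x xB; apply: BX => //; have := ltn_ord i; have := prime_gt1 p_pr; lia.
rewrite sum_mxtrace_reg // sumr_const card_ord -mulrnA => /eqP.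
rewrite mulrn_eq0 muln_eq0 -[#|gT|]cardsT.
have -> : (#|[set: gT]| == 0)%N = false.
  by apply/negbTE; rewrite -lt0n; apply/card_gt0P; exists 1%g; rewrite inE.
have -> : (p.-1 == 0)%N = false by have := prime_gt1 p_pr; case: p {p_pr pm ordB BX free} => [|[]].
by move/eqP.
Qed.

(** Let X be x on the left and w on the right. As w^2 = 1, X^2 is left multiplication by x^2, hence
    free modulo 2, and so is X by [rank_norm_char2]. The trace for X^2 vanishes by the case w = 1
    for x^2; those for X and X^3 are exchanged by x -> x^-1. *)
Lemma class_sum_order4 (m : nat) B v w : odd m -> v ^+ m = 1 -> w ^+ 2 = 1 ->
    GRing.comm v w -> conj_closed B -> (forall x, x \in B -> #[x]%g = 4%N) ->
    (forall x, x \in B -> (x ^- 1)%g \in B) ->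
  class_sum B ((\sum_(j < m) v ^+ j) * w) = 0.
Proof.
move=> odd_m vm w2 vw Bcl ordB Binv; set s := \sum_(j < m) v ^+ j.
have m2 : ~~ (2 %| m)%N by rewrite dvdn2 odd_m.
have free x : x \in B ->
    \tr (lmul int x * reg (s * w)) + \tr (lmul int x^-1%g * reg (s * w)) = 0.
  move=> xB; have ox := ordB x xB.
  have x4 : (x ^+ 4 = 1)%g by rewrite -ox expg_order.
  have ox2 : #[(x ^+ 2)%g]%g = 2%N by rewrite orderXdiv ox.
  have free2 : (#|gT| <= 2 * rk (\sum_(i < 2) lmul 'F_2 ((x ^+ 2) ^+ i)%g))%N.
    by have := rank_lmul_norm 'F_2 (x ^+ 2)%g; rewrite ox2.
  have tr2 : \tr (lmul int (x ^+ 2)%g * reg s) = 0.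
    have := @reg_free_trace 2 1 m (x ^+ 2)%g v 1 isT isT m2 vm (commr1 v).
    rewrite reg1 mulr1 -lmulX -expgM x4 lmul1 => /(_ erefl).
    rewrite (eq_bigr (fun i : 'I_(2 ^ 1) => lmul 'F_2 ((x ^+ 2) ^+ i)%g)); last first.
      by move=> i _; rewrite map_fmx -lmulX.
    move=> /(_ free2); rewrite big_ord_recl big_ord0 addr0 /= !expr1 mulr1.
    by rewrite expg1.
  have X2 : (lmul int x * reg w) ^+ 2 = lmul int (x ^+ 2)%g.
    by rewrite exprMn_comm; [rewrite -regX w2 reg1 mulr1 -lmulX | exact: lmul_reg].
  have := @reg_free_trace 2 2 m x v w isT isT m2 vm vw.
  rewrite -[(2 ^ 2)%N]/4%N (exprM _ 2 2) X2 -lmulX -expgM x4 lmul1 => /(_ erefl).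
  have free4 : (#|gT| <= 4 * rk (\sum_(i < 4)
       map_mx (intr : int -> 'F_2) (lmul int x * reg w) ^+ i))%N.
    apply: rank_norm_char2; first exact: pchar_Fp.
      by rewrite -map_mxX_int (exprM _ 2 2) X2 -lmulX -expgM x4 lmul1 map_mx1.
    rewrite -map_mxX_int X2 (eq_bigr (fun i : 'I_2 => lmul 'F_2 ((x ^+ 2) ^+ i)%g)) //.
    by move=> i _; rewrite map_fmx -lmulX.
  move=> /(_ free4); rewrite !big_ord_recl big_ord0 addr0 /= /bump /= !add1n.
  rewrite expr1 expg1 w2 mulr1 tr2 add0r.
  by rewrite exprS w2 mulr1 -[(x ^+ 3)%g](mulKg x) -expgS x4 mulg1.
have: \sum_(x in B) (\tr (lmul int x * reg (s * w)) +
                     \tr (lmul int x^-1%g * reg (s * w))) = 0.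
  by rewrite big1 // => x xB; exact: free.
rewrite big_split /= [X in _ + X](reindex_inj invg_inj) /=.
rewrite [X in _ + X](eq_big (mem B) (fun x => \tr (lmul int x * reg (s * w)))).
- rewrite sum_mxtrace_reg // -mulr2n -mulrnA => /eqP.
  rewrite mulrn_eq0 muln_eq0 /= orbF.
  have -> : (#|gT| == 0)%N = false.
    by apply/negbTE; rewrite -lt0n; apply/card_gt0P; exists 1%g.
  by move/eqP.
- move=> x; apply/idP/idP => xB; last exact: Binv.
  by rewrite -[x]invgK; exact: Binv.
- by move=> x _; rewrite invgK.
Qed.

(** A rational matrix of finite order has the same trace as its inverse; apply this to x on the left
    and v on the right. *)
Lemma class_sum_inv B v w N : (0 < N)%N -> v ^+ N = 1 -> v * w = 1 -> w * v = 1 ->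
    conj_closed B -> (forall x, x \in B -> x^-1%g \in B) ->
  class_sum B w = class_sum B v.
Proof.
move=> N0 vN vw wv Bcl Binv.
have trE x : \tr (lmul int x^-1%g * reg w) = \tr (lmul int x * reg v).
  apply: (@intr_inj rat); rewrite -!trace_map_int.
  apply: (@mxtrace_finite_order_inv _ _ _ _ (N * #[x]%g)%N).
  - by rewrite muln_gt0 N0 order_gt0.
  - rewrite -map_mxX_int exprMn_comm; last exact: lmul_reg.
    rewrite -lmulX -regX exprM vN expr1n mulnC expgM expg_order expg1n.
    by rewrite lmul1 reg1 mulr1 map_mx1.
  - rewrite -map_mxM_int -mulrA (mulrA (reg v)) -(lmul_reg x^-1%g v) -mulrA -regM vw reg1 mulr1.
    by rewrite -lmulM mulgV lmul1 map_mx1.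
  - rewrite -map_mxM_int -mulrA (mulrA (reg w)) -(lmul_reg x w) -mulrA -regM wv reg1 mulr1.
    by rewrite -lmulM mulVg lmul1 map_mx1.
have cardn : #|gT| != 0%N by rewrite -lt0n; apply/card_gt0P; exists 1%g.
apply/eqP; rewrite -subr_eq0 -[_ == 0]orFb -(negbTE cardn) -mulrn_eq0 mulrnBl.
rewrite subr_eq0 -!sum_mxtrace_reg //; apply/eqP.
rewrite [LHS](reindex_inj invg_inj); apply: eq_big => x //=.
by apply/idP/idP => xB; [rewrite -[x]invgK|]; exact: Binv.
Qed.

End ClassSums.

(** * Traces of idempotents, and coefficients of squares modulo 2 *)

Lemma gr_coefMn (R : nzRingType) (gT : finGroupType) (v : group_ring R gT) n g :
  coef (v *+ n) g = coef v g *+ n.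
Proof.
elim: n => [|n IHn]; first by rewrite !mulr0n /coef ffunE.
by rewrite !mulrS gr_coefD IHn.
Qed.

Lemma gr_eqP (R : nzRingType) (gT : finGroupType) (v w : group_ring R gT) :
  (forall g, coef v g = coef w g) -> v = w.
Proof. by move=> vw; apply/ffunP. Qed.

Lemma gr_coef0 (R : nzRingType) (gT : finGroupType) g :
  coef (0 : group_ring R gT) g = 0.
Proof. by rewrite /coef ffunE. Qed.

(** E times the image of f/c is an idempotent matrix; its trace is its rank k. *)
Lemma trace_idem_rep (gT : finGroupType) n (P : gT -> 'M[rat]_n) (E : 'M[rat]_n)
    (f : group_ring int gT) (c : nat) :
    P 1%g = 1 -> (forall g h, P (g * h)%g = P g * P h) ->
    (forall g, GRing.comm E (P g)) -> E * E = E -> (0 < c)%N -> f * f = f *+ c ->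
  exists2 k : nat, \sum_g (coef f g)%:~R * \tr (E * P g) = (c * k)%:R
    & k = 0%N -> E * rep P f = 0.
Proof.
move=> P1 PM EP EE c0 ff; have c_neq0 : c%:R != 0 :> rat by rewrite pnatr_eq0; lia.
have Ef := commr_rep f EP.
pose Q := c%:R^-1 *: (E * rep P f).
have QQ : Q * Q = Q.
  have -> : Q * Q = (c%:R^-1 * c%:R^-1) *: (E * rep P (f * f)).
    rewrite /Q !scalemxM scalerA -[E * _ * _]mulrA (mulrA (rep P f)) -Ef.
    by rewrite -(mulrA E (rep P f)) (mulrA E E) EE -repM.
  by rewrite ff repMn -scaler_nat !scalemxM scalerA mulfVK.
exists (rk Q) => [|r0].
  by rewrite natrM -mxtrace_idem ?mulmxE // mxtraceZ mulVKf // trace_rep.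
have /eqP : rk Q = 0%N by [].
by rewrite mxrank_eq0 /Q scalemx_eq0 invr_eq0 (negPf c_neq0) => /eqP.
Qed.

Section Coefficients.
Variable gT : finGroupType.
Implicit Types (u v w f : group_ring int gT) (x y g : gT) (B : {set gT}).

Lemma rep_rmul v : rep (rmul rat) v = kmx (fun y z => (coef v (y^-1 * z)%g)%:~R).
Proof.
apply/matrixP => a b; rewrite /rep summxE mxE.
set y := enum_val a; set z := enum_val b.
rewrite (bigD1 (y^-1 * z)%g) //= !mxE -/y -/z mulKVg eqxx mulr1 big1 ?addr0 //.
move=> g gyz; rewrite !mxE -/y -/z; case: eqP => [yg|]; last by rewrite mulr0.
by rewrite -yg mulKg eqxx in gyz.
Qed.

(** The regular trace of f is #|gT| times its coefficient at 1, and also c times a rank. *)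
Lemma coef1_idem f (c : nat) : (0 < c)%N -> f * f = f *+ c ->
  0 <= coef f 1%g /\ (coef f 1%g = 0 -> f = 0).
Proof.
move=> c0 ff; have comm1 g : GRing.comm 1 (rmul rat g).
  by apply: commr_sym; exact: commr1.
have [k trf f0] := trace_idem_rep (rmul1 _ _) (@rmulM _ _) comm1 (mul1r 1) c0 ff.
have n0 : (0 < #|gT|)%N by apply/card_gt0P; exists 1%g.
have trE : (coef f 1%g)%:~R * #|gT|%:R = (c * k)%:R :> rat.
  rewrite -trf (bigD1 1%g) //= mul1r rmul1.
  rewrite (_ : \tr _ = #|gT|%:R); last exact: mxtrace1.
  rewrite big1 ?addr0 // => g g1; rewrite mul1r mxtrace_kmx big1 ?mulr0 // => y _.
  by rewrite -{2}[y]mulg1 (inj_eq (mulgI y)) (negPf g1).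
split.
  rewrite -(ler0z rat) -(pmulr_lge0 _ (_ : 0 < #|gT|%:R)) ?ltr0n //.
  by rewrite trE ler0n.
move=> f1; move: trE; rewrite f1 mul0r => /esym/eqP.
rewrite pnatr_eq0 muln_eq0 => /orP[/eqP c0'|/eqP k0]; first by rewrite c0' in c0.
move: (f0 k0); rewrite mul1r rep_rmul => /matrixP fM; apply: gr_eqP => g.
have := fM (enum_rank 1%g) (enum_rank g).
rewrite !mxE !enum_rankK invg1 mul1g gr_coef0 => /eqP.
by rewrite intr_eq0 => /eqP.
Qed.

Lemma sum_sym_mod2 (T : eqType) (s : seq T) (a : T -> T -> int) :
  (forall x y : T, a x y = a y x) ->
  exists c, \sum_(x <- s) \sum_(y <- s) a x y = \sum_(x <- s) a x x + c *+ 2.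
Proof.
move=> a_sym; elim: s => [|x s [c IH]]; first by exists 0; rewrite !big_nil.
have cols : \sum_(z <- s) \sum_(y <- x :: s) a z y =
    \sum_(y <- s) a x y + \sum_(z <- s) \sum_(y <- s) a z y.
  rewrite -big_split; apply: eq_bigr => z _.
  by rewrite big_cons a_sym.
exists (c + \sum_(y <- s) a x y); rewrite 2!big_cons cols IH big_cons.
by rewrite mulrnDl mulr2n; ring.
Qed.

(** In v^2 the products x y and y x are conjugate and carry equal coefficients, so modulo 2 only the
    squares x^2 remain, and z^2 = z modulo 2. *)
Lemma class_sum_sqr B v : conj_closed B -> (forall x, ((x ^+ 2)%g \in B) = (x \in B)) ->
  exists c, class_sum B (v ^+ 2) = class_sum B v + c *+ 2.
Proof.
move=> Bcl B2; pose a x y : int := ((x * y)%g \in B)%:R * (coef v x * coef v y).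
have a_sym x y : a x y = a y x.
  by rewrite /a -(Bcl (x * y)%g x) conjgE mulgA mulKg [coef v x * _]mulrC.
have -> : class_sum B (v ^+ 2) = \sum_(x <- index_enum gT) \sum_(y <- index_enum gT) a x y.
  rewrite /class_sum; under eq_bigr => z _ do rewrite expr2 gr_coefM.
  rewrite exchange_big /=; apply: eq_bigr => x _.
  rewrite (reindex_inj (mulgI x)) /= big_mkcond /=; apply: eq_bigr => y _.
  by rewrite /a mulKg; case: ifP => _; rewrite ?mul1r ?mul0r.
have [c ->] := sum_sym_mod2 (index_enum gT) a_sym.
have sq (z : int) : exists d, z * z = z + d *+ 2.
  have [k [->|->]] : exists k : int, z = k *+ 2 \/ z = k *+ 2 + 1.
    by exists (z %/ 2)%Z; lia.
  - by exists (2 * k * k - k); ring.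
  - by exists (2 * k * k + k); ring.
have [d dE] : exists d, \sum_x a x x = class_sum B v + d *+ 2.
  rewrite /class_sum big_mkcond /=; elim: (index_enum gT) => [|x s [d IH]].
    by exists 0; rewrite !big_nil.
  have [e eE] := sq (coef v x).
  exists (d + e *+ (x \in B)); rewrite !big_cons IH /a -[(x * x)%g]/(x ^+ 2)%g B2.
  by case: ifP => _; rewrite ?mul1r ?mul0r ?eE ?mulr1n ?mulr0n; ring.
by exists (d + c); rewrite dE; ring.
Qed.

End Coefficients.

Section LinearCharacter.
Variables (gT : finGroupType) (lam : gT -> int).
Hypotheses (lam1 : lam 1%g = 1) (lamM : forall g h, lam (g * h)%g = lam g * lam h).

Definition char_sum (v : group_ring int gT) : int := \sum_g coef v g * lam g.

Lemma char_sum1 : char_sum 1 = 1.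
Proof.
rewrite /char_sum (bigD1 1%g) //= gr_coef1 eqxx lam1 mul1r big1 ?addr0 //.
by move=> g /negPf g1; rewrite gr_coef1 g1 mul0r.
Qed.

Lemma char_sumM v w : char_sum (v * w) = char_sum v * char_sum w.
Proof.
rewrite /char_sum mulr_suml.
under [RHS]eq_bigr => h _ do
  rewrite mulr_sumr (reindex_inj (mulgI h^-1%g)) /=.
rewrite [RHS]exchange_big; apply: eq_bigr => g _.
rewrite gr_coefM mulr_suml; apply: eq_bigr => h _.
by rewrite mulrACA -lamM mulKVg.
Qed.

Lemma char_sumX v i : char_sum (v ^+ i) = char_sum v ^+ i.
Proof. by elim: i => [|i IHi]; rewrite ?expr0 ?char_sum1 // !exprS char_sumM IHi. Qed.

End LinearCharacter.

(** * Partial augmentations of a unit of order 6; [chi] is false on A6 *)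

Section OrderSix.
Variables (gT : finGroupType) (chi : gT -> bool).
Hypotheses (chiM : forall g h, chi (g * h)%g = chi g (+) chi h).
Hypotheses (even_order : forall g, ~~ chi g -> (#[g]%g <= 5)%N).
Hypotheses (order_neq6 : forall g : gT, #[g]%g != 6%N).
Implicit Types (u v w f : group_ring int gT) (x y g : gT).

Definition sgn_chi g : int := if chi g then -1 else 1.

Definition even_class k : {set gT} := [set g | ~~ chi g & #[g]%g == k].

Local Notation ps k v := (class_sum (even_class k%N) v).

Lemma chi1 : chi 1%g = false.
Proof. by have := chiM 1 1; rewrite mulg1; case: (chi 1%g). Qed.

Lemma chiX g i : chi (g ^+ i)%g = chi g && odd i.
Proof.
elim: i => [|i IHi]; first by rewrite expg0 chi1 andbF.
by rewrite expgS chiM IHi /=; case: (chi g); case: (odd i).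
Qed.

Lemma chiV g : chi g^-1%g = chi g.
Proof. by have := chiM g g^-1; rewrite mulgV chi1; case: (chi g); case: (chi _). Qed.

Lemma sgn_chi1 : sgn_chi 1%g = 1. Proof. by rewrite /sgn_chi chi1. Qed.

Lemma sgn_chiM g h : sgn_chi (g * h)%g = sgn_chi g * sgn_chi h.
Proof. by rewrite /sgn_chi chiM; case: (chi g); case: (chi h). Qed.

Lemma even_class_conj k : conj_closed (even_class k).
Proof.
by move=> x y; rewrite !inE orderJ conjgE !chiM chiV addbC -addbA addbb addbF.
Qed.

Lemma even_class_inv k x : x \in even_class k -> x^-1%g \in even_class k.
Proof. by rewrite !inE chiV orderV. Qed.

Lemma even_class1 v : ps 1 v = coef v 1%g.
Proof.
rewrite /class_sum (big_pred1 1%g) // => g; rewrite !inE order_eq1.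
by case: eqP => [->|]; rewrite ?chi1 ?andbF.
Qed.

Lemma even_class_one k : ps k 1 = (k == 1%N)%:R.
Proof.
rewrite /class_sum; case: (boolP (1%g \in even_class k)); rewrite !inE order1 chi1 /=.
  move=> /eqP <-; rewrite (bigD1 1%g) ?inE ?order1 ?chi1 //= gr_coef1 eqxx.
  by rewrite big1 ?addr0 // => g /andP[_ /negPf g1]; rewrite gr_coef1 g1.
rewrite eq_sym => /negPf k1; rewrite k1 big1 // => g.
by rewrite gr_coef1 inE; case: (g =P 1%g) => // ->; rewrite order1 eq_sym k1 andbF.
Qed.

Lemma sum_even_class v (F : gT -> int) (c : nat -> int) :
    (forall g, ~~ chi g -> F g = c #[g]%g) ->
  \sum_(g | ~~ chi g) coef v g * F g = \sum_(k < 6) c k * ps k v.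
Proof.
move=> Fc; have ord6 g : ~~ chi g -> (#[g]%g < 6)%N by move/even_order.
rewrite (partition_big (fun g => inord #[g]%g : 'I_6) xpredT) //=.
apply: eq_bigr => k _; rewrite mulr_sumr; apply: eq_big => g.
  rewrite inE; case: (boolP (chi g)) => //= cg.
  by rewrite -val_eqE /= inordK // ord6.
move=> /andP[cg /eqP <-]; rewrite inordK ?ord6 // Fc //; exact: mulrC.
Qed.

(** 1 + [sgn_chi] is twice the indicator function of the kernel of [chi]. *)
Lemma even_total v : augmentation v = 1 ->
  2 * (ps 1 v + ps 2 v + ps 3 v + ps 4 v + ps 5 v) = 1 + char_sum sgn_chi v.
Proof.
move=> aug; have := @sum_even_class v (fun=> 1) (fun=> 1) (fun g _ => erefl).
rewrite !big_ord_recl big_ord0 /= /bump /= !add1n !mul1r addr0.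
have -> : ps 0 v = 0.
  rewrite /class_sum big_pred0 // => g; rewrite inE; apply/negbTE.
  by rewrite negb_and -lt0n order_gt0 orbT.
rewrite add0r !addrA => <-.
transitivity (augmentation v + char_sum sgn_chi v); last by rewrite aug.
rewrite /augmentation /char_sum.
rewrite mulr_sumr -big_split /= [RHS](bigID chi) /= [X in X + _]big1 ?add0r.
  apply: eq_bigr => g /negPf cg; rewrite /sgn_chi cg /=; ring.
by move=> g cg; rewrite /sgn_chi cg /=; ring.
Qed.

Lemma gr_intmulI m v w : (0 < m)%N -> v *+ m = w *+ m -> v = w.
Proof.
move=> m0 vw; apply: gr_eqP => g; have := congr1 (fun z => coef z g) vw.
by rewrite /= !gr_coefMn => /(pmulrnI m0).
Qed.

(** Both N, the sum of the powers of v, and m - N are m times idempotents, so [coef1_idem] bounds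
    the coefficient of N at 1 on both sides. If N = m, then v N = N gives v = 1. *)
Lemma coef1_cyclic_sum v m : (0 < m)%N -> v ^+ m = 1 ->
  [/\ 0 <= \sum_(i < m) coef (v ^+ i) 1%g, \sum_(i < m) coef (v ^+ i) 1%g <= m%:Z
    & \sum_(i < m) coef (v ^+ i) 1%g = m%:Z -> v = 1].
Proof.
move=> m0 vm; rewrite -gr_coef_sum; set N := \sum_(i < m) v ^+ i.
have NN : N * N = N *+ m by exact: sqr_cyclic_sum.
have [N0 _] := coef1_idem m0 NN.
have coefm : coef (m%:R : group_ring int gT) 1%g = m%:Z.
  by rewrite gr_coefMn gr_coef1 eqxx natz.
set M : group_ring int gT := m%:R - N.
have MN : M * N = 0 by rewrite mulrBl NN mulr_natl subrr.
have MM : M * M = M *+ m by rewrite {2}/M mulrBr MN subr0 mulr_natr.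
have [M0 M_eq0] := coef1_idem m0 MM.
rewrite gr_coefB coefm in M0 M_eq0; split=> //; first by rewrite -subr_ge0.
move=> Nm; move: M_eq0; rewrite Nm subrr => /(_ erefl) /eqP.
rewrite subr_eq0 => /eqP mE; apply: (gr_intmulI m0).
by rewrite -[LHS]mulr_natr mE mulr_cyclic_sum.
Qed.

Section Isotypic.
Variables (n : nat) (P : gT -> 'M[rat]_n) (E : 'M[rat]_n) (c : nat -> int).
Hypotheses (P1 : P 1%g = 1) (PM : forall g h, P (g * h)%g = P g * P h).
Hypotheses (EP : forall g, GRing.comm E (P g)) (EE : E * E = E).
Hypothesis trE : forall g, ~~ chi g -> \tr (E * P g) = (c #[g]%g)%:~R.

Definition twist g : 'M[rat]_n := (sgn_chi g)%:~R *: P g.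

Lemma twist1 : twist 1%g = 1.
Proof. by rewrite /twist sgn_chi1 P1 scale1r. Qed.

Lemma twistM g h : twist (g * h)%g = twist g * twist h.
Proof. by rewrite /twist sgn_chiM rmorphM !scalemxM scalerA PM. Qed.

Lemma twist_comm g : GRing.comm E (twist g).
Proof. by rewrite /GRing.comm /twist !scalemxM EP. Qed.

Definition even_char f : int := \sum_(k < 6) c k * ps k f.

(** In the sum of the traces for [P] and [twist] the elements outside the kernel cancel, so the
    values of the character on the kernel suffice. The natural number k is a sum of two ranks, so k
    = 0 kills both. *)
Lemma even_rank f (m : nat) : (0 < m)%N -> f * f = f *+ m ->
  exists2 k : nat, 2 * even_char f = (m * k)%:Z &
    k = 0%N -> E * rep P f = 0 /\ E * rep twist f = 0.
Proof.
move=> m0 ff; have [k1 tr1 z1] := trace_idem_rep P1 PM EP EE m0 ff.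
have [k2 tr2 z2] := trace_idem_rep twist1 twistM twist_comm EE m0 ff.
exists (k1 + k2)%N => [|k0]; last by split; [apply: z1 | apply: z2]; lia.
apply: (@intr_inj rat); rewrite mulnDr PoszD rmorphD /= -!pmulrn -tr1 -tr2.
rewrite -big_split /= (bigID chi) /= [X in X + _]big1 ?add0r => [|g cg]; last first.
  by rewrite /twist /sgn_chi cg scalemxM mxtraceZ; ring.
rewrite /even_char -(sum_even_class f (F := fun g => c #[g]%g)) // mulr_sumr.
rewrite rmorph_sum; apply: eq_bigr => g /negPf cg /=.
rewrite /twist /sgn_chi cg scale1r trE ?cg // !rmorphM /=.
by ring.
Qed.

End Isotypic.

Section Unit.
Variable u : group_ring int gT.
Hypotheses (aug_u : augmentation u = 1) (u6 : u ^+ 6 = 1).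
Hypotheses (u2 : u ^+ 2 <> 1) (u3 : u ^+ 3 <> 1).

Lemma comm_uX i j : GRing.comm (u ^+ i) (u ^+ j).
Proof. by apply: commrX; apply: commr_sym; apply: commrX. Qed.

Lemma u2_exp3 : (u ^+ 2) ^+ 3 = 1. Proof. by rewrite -exprM. Qed.
Lemma u3_exp2 : (u ^+ 3) ^+ 2 = 1. Proof. by rewrite -exprM. Qed.

Lemma ps_inv k i : (0 < i < 6)%N -> ps k (u ^+ (6 - i)) = ps k (u ^+ i).
Proof.
move=> i6; apply: (@class_sum_inv _ _ _ _ 6) => //.
- by rewrite -exprM mulnC exprM u6 expr1n.
- by rewrite -exprD subnKC ?u6 //; lia.
- by rewrite -exprD subnK ?u6 //; lia.
- exact: even_class_conj.
- exact: even_class_inv.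
Qed.

Lemma ps5 k : ps k (u ^+ 5) = ps k u.
Proof. exact: (@ps_inv k 1 isT). Qed.

Lemma ps4 k : ps k (u ^+ 4) = ps k (u ^+ 2).
Proof. exact: (@ps_inv k 2 isT). Qed.

Lemma prime_class_sum0 (p m : nat) v : prime p -> ~~ (p %| m)%N -> v ^+ m = 1 ->
  \sum_(j < m) ps p (v ^+ j) = 0.
Proof.
move=> p_pr pm vm; rewrite -class_sum_sum.
apply: (class_sum_coprime p_pr pm vm); first exact: even_class_conj.
  by move=> x; rewrite inE => /andP[_ /eqP].
move=> x i; rewrite !inE => /andP[cx /eqP ox] ip; rewrite chiX (negPf cx) /=.
rewrite orderXgcd ox; have /eqP -> : coprime p i.
  by rewrite prime_coprime //; apply/negP => /dvdn_leq; lia.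
by rewrite divn1.
Qed.

Lemma augE v : augmentation v = char_sum (fun=> 1) v.
Proof. by apply: eq_bigr => g _; rewrite mulr1. Qed.

Lemma aug_uX i : augmentation (u ^+ i) = 1.
Proof. by rewrite augE char_sumX // -augE aug_u expr1n. Qed.

Lemma ps_two_s : ps 2 (u ^+ 2) = 0.
Proof.
have := @prime_class_sum0 2 3 (u ^+ 2) isT isT u2_exp3.
rewrite !big_ord_recl big_ord0 /= /bump /= !addn0 -!exprM muln1 ps4 expr0 even_class_one /=.
by lia.
Qed.

Lemma ps_three_t : ps 3 (u ^+ 3) = 0.
Proof.
have := @prime_class_sum0 3 2 (u ^+ 3) isT isT u3_exp2.
rewrite !big_ord_recl big_ord0 /= /bump /= !addn0 -!exprM muln1 expr0 even_class_one /=.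
by lia.
Qed.

Lemma ps_five : [/\ ps 5 u = 0, ps 5 (u ^+ 2) = 0 & ps 5 (u ^+ 3) = 0].
Proof.
have := @prime_class_sum0 5 3 (u ^+ 2) isT isT u2_exp3.
have := @prime_class_sum0 5 2 (u ^+ 3) isT isT u3_exp2.
have := @prime_class_sum0 5 6 u isT isT u6.
rewrite !big_ord_recl !big_ord0 /= /bump /= !addn0 -!exprM !muln1.
rewrite -[(1 + 1)%N]/2%N -[(1 + 2)%N]/3%N -[(1 + 3)%N]/4%N -[(1 + 4)%N]/5%N.
by rewrite -[(2 * 2)%N]/4%N ps4 ps5 !expr0 expr1 even_class_one /= => e1 e2 e3; split; lia.
Qed.

(** Apply [class_sum_order4] with (v, w) equal to (1, u^3), (u^2, 1) and (u^2, u^3). *)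
Lemma ps_four : [/\ ps 4 u = 0, ps 4 (u ^+ 2) = 0 & ps 4 (u ^+ 3) = 0].
Proof.
have H m v w : odd m -> v ^+ m = 1 -> w ^+ 2 = 1 -> GRing.comm v w ->
    \sum_(j < m) ps 4 (v ^+ j * w) = 0.
  move=> om vm w2 vw; rewrite -class_sum_sum -mulr_suml.
  apply: class_sum_order4 => //; first exact: even_class_conj.
    by move=> x; rewrite inE => /andP[_ /eqP].
  by move=> x; exact: even_class_inv.
have := H 1%N 1 (u ^+ 3) isT (expr1n _ 1) u3_exp2 (commr_sym (commr1 _)).
have := H 3%N (u ^+ 2) 1 isT u2_exp3 (expr1n _ 2) (commr1 _).
have := H 3%N (u ^+ 2) (u ^+ 3) isT u2_exp3 u3_exp2 (comm_uX 2 3).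
rewrite !big_ord_recl !big_ord0 /= /bump /= !addn0 -!exprM !muln1 expr1n !mulr1 !mul1r -!exprD.
have -> : u ^+ (2 * 2 + 3) = u by rewrite -[(2 * 2 + 3)%N]/(6 + 1)%N exprD u6 mul1r.
rewrite -[(2 + 3)%N]/5%N -[(2 * (1 + 1))%N]/4%N ps4 ps5 !expr0 even_class_one /=.
by move=> e1 e2 e3; split; lia.
Qed.

(** The bounds of [coef1_cyclic_sum] for u^2, u^3, -u^3, u and -u leave only 0, once u^2 = 1, u^3 =
    1 and, by augmentation, u^3 = -1 are excluded. *)
Lemma ps_one : [/\ ps 1 u = 0, ps 1 (u ^+ 2) = 0 & ps 1 (u ^+ 3) = 0].
Proof.
rewrite !even_class1.
have co5 : coef (u ^+ 5) 1%g = coef u 1%g by rewrite -!even_class1 ps5.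
have co4 : coef (u ^+ 4) 1%g = coef (u ^+ 2) 1%g by rewrite -!even_class1 ps4.
have coN v : coef (- v) 1%g = - coef v 1%g by rewrite /coef ffunE.
have co1 : coef (1 : group_ring int gT) 1%g = 1 by rewrite gr_coef1 eqxx.
have [t0 t1 t_neq1] := coef1_cyclic_sum (ltn0Sn 1) u3_exp2.
have [s0 s1 s_neq1] := coef1_cyclic_sum (ltn0Sn 2) u2_exp3.
have [u0 u1 _] := coef1_cyclic_sum (ltn0Sn 5) u6.
have Nt2 : (- u ^+ 3) ^+ 2 = 1 by rewrite sqrrN u3_exp2.
have Nu6 : (- u) ^+ 6 = 1 by rewrite -[6%N]/(2 * 3)%N exprM sqrrN -exprM.
have [nt0 nt1 nt_neq1] := coef1_cyclic_sum (ltn0Sn 1) Nt2.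
have [nu0 nu1 _] := coef1_cyclic_sum (ltn0Sn 5) Nu6.
have neg v i : coef ((- v) ^+ i) 1%g = (-1) ^+ i * coef (v ^+ i) 1%g.
  rewrite [in LHS]exprNn -[in LHS]signr_odd -[in RHS]signr_odd.
  by case: (odd i); rewrite /= !(expr1, expr0, mulN1r, mul1r) ?coN.
have sum2 (F : nat -> int) : \sum_(i < 2) F i = F 0%N + F 1%N.
  by rewrite !big_ord_recl big_ord0 /= addr0.
have sum3 (F : nat -> int) : \sum_(i < 3) F i = F 0%N + F 1%N + F 2%N.
  by rewrite !big_ord_recl big_ord0 /= addr0 addrA.
rewrite (sum2 (fun i => coef ((u ^+ 3) ^+ i) 1%g)) expr0 expr1 co1 in t0 t1 t_neq1.
rewrite (sum2 (fun i => coef ((- u ^+ 3) ^+ i) 1%g)) !neg expr0 !expr1 co1 in nt0 nt1 nt_neq1.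
rewrite (sum3 (fun i => coef ((u ^+ 2) ^+ i) 1%g)) expr0 expr1 -exprM -[(2 * 2)%N]/4%N co1 co4 in s0 s1 s_neq1.
rewrite (sum6 (fun i => coef (u ^+ i) 1%g)) expr0 expr1 co1 co5 co4 in u0 u1.
rewrite (sum6 (fun i => coef ((- u) ^+ i) 1%g)) !neg expr0 expr1 co1 co5 co4 in nu0 nu1.
have aug_t := aug_uX 3.
have aug_t1 : augmentation (- 1 : group_ring int gT) = -1.
  rewrite -[RHS](_ : - augmentation (1 : group_ring int gT) = _); last by rewrite augE char_sum1.
  by rewrite /augmentation -sumrN; apply: eq_bigr => g _; rewrite /coef ffunE.
have t_neqN1 : u ^+ 3 <> -1 by move=> tE; move: aug_t; rewrite tE aug_t1.
have t1E : coef (u ^+ 3) 1%g = 0.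
  case: (eqVneq (coef (u ^+ 3) 1%g) 1) => [tE|]; first by case: u3; apply: t_neq1; rewrite tE.
  case: (eqVneq (coef (u ^+ 3) 1%g) (-1)) => [tE|].
    by case: t_neqN1; apply: oppr_inj; rewrite opprK; apply: nt_neq1; rewrite tE.
  by move: t0 t1 nt0 nt1; lia.
have s1E : coef (u ^+ 2) 1%g = 0.
  case: (eqVneq (coef (u ^+ 2) 1%g) 1) => [sE|]; first by case: u2; apply: s_neq1; rewrite sE.
  by move: s0 s1; lia.
split=> //; move: u0 u1 nu0 nu1; rewrite t1E s1E !mulr0 expr1 -[(-1) ^+ 5]/(-1 : int); lia.
Qed.

Lemma even_total_uX i : ps 1 (u ^+ i) = 0 -> ps 4 (u ^+ i) = 0 -> ps 5 (u ^+ i) = 0 ->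
  2 * (ps 2 (u ^+ i) + ps 3 (u ^+ i)) = 1 + char_sum sgn_chi u ^+ i.
Proof.
move=> p1 p4 p5; have := even_total (aug_uX i).
rewrite p1 p4 p5 add0r !addr0 => ->.
by rewrite char_sumX //; [exact: sgn_chi1 | exact: sgn_chiM].
Qed.

Lemma char_u : char_sum sgn_chi u = 1 \/ char_sum sgn_chi u = -1.
Proof.
have := char_sumX sgn_chi1 sgn_chiM u 6; rewrite u6 char_sum1 ?sgn_chi1 //.
move/esym/eqP; rewrite -[6%N]/(2 * 3)%N exprM => /eqP e6.
have : char_sum sgn_chi u ^+ 2 = 1 by nia.
by move/eqP; rewrite sqrf_eq1 => /orP[] /eqP; [left | right].
Qed.

Lemma ps_three_s : ps 3 (u ^+ 2) = 1.
Proof.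
have [_ p1 _] := ps_one; have [_ p4 _] := ps_four; have [_ p5 _] := ps_five.
have := even_total_uX p1 p4 p5; rewrite ps_two_s.
by case: char_u => ->; rewrite ?sqrrN expr1n; lia.
Qed.

(** If x^2 has order 3, then x has order 3 or 6, and 6 does not occur; so the elements of order 3
    satisfy the hypotheses of [class_sum_sqr]. *)
Lemma ps_three_odd : exists c, ps 3 u = 1 + c *+ 2.
Proof.
have [|c] := @class_sum_sqr _ (even_class 3) u (even_class_conj 3).
  move=> x; rewrite !inE chiX andbF /=; apply/idP/andP => [/eqP ox2|[_ /eqP ox]].
    have x6 : (#[x]%g %| 6)%N.
      by have := expg_order (x ^+ 2)%g; rewrite ox2 -expgM => /eqP; rewrite order_dvdn.
    have ox : #[x]%g = 3%N.
      move: ox2 (order_neq6 x) x6 (@dvdn_leq _ 6 isT x6); rewrite orderXgcd.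
      by case: #[x]%g => [|[|[|[|[|[|[|n]]]]]]].
    split; last by rewrite ox.
    have x3 : (x ^+ 3)%g = 1%g by rewrite -ox expg_order.
    by have := chiX x 4; rewrite expgS x3 mulg1 andbF => ->.
  by rewrite orderXgcd ox.
by rewrite ps_three_s => oneE; exists (- c); rewrite mulNrn [X in X - _]oneE addrK.
Qed.

(** Here 2e = 1 + sgn(u), and [even_total] is used for u and u^3. *)
Lemma ps_u : exists2 e : int, e = 0 \/ e = 1 &
  exists a : int, [/\ ps 2 u = a, ps 3 u = e - a, ps 2 (u ^+ 3) = e &
    exists c, e - a = 1 + c *+ 2].
Proof.
have [p1u p1s p1t] := ps_one; have [p4u p4s p4t] := ps_four.
have [p5u p5s p5t] := ps_five.
have := @even_total_uX 1; rewrite !expr1 => /(_ p1u p4u p5u).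
have := even_total_uX p1t p4t p5t; rewrite ps_three_t addr0.
have [c pc] := ps_three_odd.
have -> : char_sum sgn_chi u ^+ 3 = char_sum sgn_chi u.
  by case: char_u => ->; rewrite ?expr1n // exprNn expr1n mulr1 signr_odd.
move=> et eu; exists (ps 2 (u ^+ 3)).
  by case: char_u => cE; rewrite cE in et; [right | left]; lia.
exists (ps 2 u); split=> //; try lia.
by exists c; lia.
Qed.

(** These three elements are 6 times the idempotents for the eigenvalues 1, -1 and the primitive
    cube roots of unity of u. *)
Definition norm6 : group_ring int gT := \sum_(i < 6) u ^+ i.
Definition alt_norm6 : group_ring int gT := \sum_(i < 6) (- u) ^+ i.
Definition mix_norm6 : group_ring int gT := (1 + u ^+ 3) *+ 3 - norm6.

Lemma sqr_norm6 : norm6 * norm6 = norm6 *+ 6.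
Proof. exact: sqr_cyclic_sum. Qed.

Lemma sqr_alt_norm6 : alt_norm6 * alt_norm6 = alt_norm6 *+ 6.
Proof. by apply: sqr_cyclic_sum; rewrite -[6%N]/(2 * 3)%N exprM sqrrN -exprM. Qed.

Lemma sqr_mix_norm6 : mix_norm6 * mix_norm6 = mix_norm6 *+ 6.
Proof.
have uiN i : u ^+ i * norm6 = norm6.
  by elim: i => [|i IH]; rewrite ?mul1r // exprSr -mulrA /norm6 mulr_cyclic_sum.
set w : group_ring int gT := 1 + u ^+ 3.
have wN : w * norm6 = norm6 *+ 2 by rewrite mulrDl mul1r uiN.
have Nuw : norm6 * w = norm6 *+ 2.
  rewrite -wN; apply: commr_sym; apply: commr_sum => i _; apply: commrX.
  by apply: commr_sym; apply: commrD; [exact: commr1 | exact: commrX].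
have ww : w * w = w *+ 2.
  rewrite {1}/w mulrDl mul1r mulr2n; congr (_ + _).
  by rewrite mulrDr mulr1 -expr2 u3_exp2 addrC.
rewrite /mix_norm6 -/w mulrBl !mulrBr sqr_norm6 !mulrnAl !mulrnAr ww wN Nuw -!mulrnA.
by rewrite subrr subr0 mulrnBl -mulrnA.
Qed.

Lemma psN k v : ps k (- v) = - ps k v.
Proof. by rewrite -sumrN; apply: eq_bigr => g _; rewrite /coef ffunE. Qed.

Lemma ps_norm6 k : ps k norm6 = (k == 1%N)%:R + ps k u *+ 2 + ps k (u ^+ 2) *+ 2 + ps k (u ^+ 3).
Proof.
rewrite /norm6 class_sum_sum (sum6 (fun i => ps k (u ^+ i))) ps4 ps5 expr0 expr1 even_class_one.
by ring.
Qed.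

Lemma ps_alt_norm6 k : ps k alt_norm6 = (k == 1%N)%:R - ps k u *+ 2 + ps k (u ^+ 2) *+ 2 - ps k (u ^+ 3).
Proof.
rewrite /alt_norm6 class_sum_sum (sum6 (fun i => ps k ((- u) ^+ i))).
have sq : (- u) ^+ 2 = u ^+ 2 by rewrite sqrrN.
have -> : (- u) ^+ 3 = - u ^+ 3 by rewrite exprS sq mulNr -exprS.
have -> : (- u) ^+ 4 = u ^+ 4 by rewrite -[4%N]/(2 * 2)%N exprM sq -exprM.
have -> : (- u) ^+ 5 = - u ^+ 5.
  by rewrite exprS -[4%N]/(2 * 2)%N exprM sq -exprM mulNr -exprS.
rewrite sq !psN ps4 ps5 expr0 even_class_one.
by ring.
Qed.

Lemma ps_mix_norm6 k : ps k mix_norm6 = (k == 1%N)%:R *+ 3 + ps k (u ^+ 3) *+ 3 - ps k norm6.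
Proof.
rewrite /mix_norm6 class_sumD psN mulrS mulr2n !class_sumD even_class_one.
by ring.
Qed.

End Unit.
End OrderSix.

(** * The contradiction, from two modules and a congruence modulo 3 *)

Section Columns.
Variables (R : comPzRingType) (T : finType).

Definition cmx (F : T -> R) : 'cV[R]_#|T| := \col_i F (enum_val i).

Lemma kmx_cmx k F : kmx k *m cmx F = cmx (fun x => \sum_y k x y * F y).
Proof.
apply/colP => i; rewrite !mxE (big_enum_val (A := T)) /=.
by apply: eq_bigr => j _; rewrite !mxE.
Qed.

Lemma fmx_cmx f F : fmx R f *m cmx F = cmx (F \o f).
Proof.
rewrite kmx_cmx; apply/colP => i; rewrite !mxE (bigD1 (f (enum_val i))) //=.
rewrite eqxx mul1r big1 ?addr0 // => y yf.
by rewrite eq_sym (negPf yf) mul0r.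
Qed.

End Columns.

(* Indexed by the order k of an element of A6: char20 is twice the character  *)
(* of degree 10, char16 the sum of the two characters of degree 8, and char6, *)
(* meaningful modulo 3 only, is minus the sum of the two 3-modular Brauer     *)
(* characters of degree 3.                                                    *)
Definition char20 (k : nat) : int := nth 0 [:: 0; 20; -4; 2; 0; 0] k.
Definition char16 (k : nat) : int := nth 0 [:: 0; 16; 0; -2; 0; 1] k.
Definition char6 (k : nat) : int := nth 0 [:: 0; 0; -1; 0; 1; -1] k.

(* k20 / 36 and k16 / 180 are idempotents of ranks 20 and 16.  The functions  *)
(* F i are integral and fixed by their sum, whence a congruence modulo 3      *)
(* between what a unit does on the image of one and on the image of the other. *)
Section Contradiction.
Variables (gT : finGroupType) (chi : gT -> bool).
Hypotheses (chiM : forall g h, chi (g * h)%g = chi g (+) chi h).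
Hypotheses (even_order : forall g, ~~ chi g -> (#[g]%g <= 5)%N).
Hypotheses (order_neq6 : forall g : gT, #[g]%g != 6%N).

Variables (T : finType) (act : gT -> {perm T}) (k20 k16 : T -> T -> int).
Hypothesis actM : forall g h, act (g * h)%g = (act g * act h)%g.
Hypothesis k20_act : forall g x y, k20 (act g x) (act g y) = k20 x y.
Hypothesis k16_act : forall g x y, k16 (act g x) (act g y) = k16 x y.
Hypothesis k20_sqr : forall x z, \sum_y k20 x y * k20 y z = 36 * k20 x z.
Hypothesis k16_sqr : forall x z, \sum_y k16 x y * k16 y z = 180 * k16 x z.
Hypothesis k20_tr : forall g, ~~ chi g ->
  \sum_x k20 (act g x) x = 36 * char20 #[g]%g.
Hypothesis k16_tr : forall g, ~~ chi g ->
  \sum_x k16 (act g x) x = 180 * char16 #[g]%g.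

Variables (I : finType) (F : I -> T -> int) (pt : I -> T).
Hypothesis F_sum : forall i x, \sum_y (5 * k20 x y + k16 x y) * F i y = 180 * F i x.
Hypothesis F_tr : forall g, ~~ chi g -> exists z,
  \sum_i \sum_y k20 (act g (pt i)) y * F i y = char6 #[g]%g + 3 * z.

Let P g : 'M[rat]_#|T| := fmx rat (act g).

Let act1 : act 1%g = 1%g.
Proof. by apply: (@mulgI _ (act 1%g)); rewrite -actM !mulg1. Qed.

Let P1 : P 1%g = 1.
Proof. by apply: fmx_id => x; rewrite act1 perm1. Qed.

Let PM g h : P (g * h)%g = P g * P h.
Proof. by rewrite /P fmxM; apply: eq_kmx => x y; rewrite actM permM. Qed.

Let Kmx (k : T -> T -> int) (d : nat) : 'M[rat]_#|T| :=
  kmx (fun x y => (k x y)%:~R / d%:R).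

Let Kmx_comm k d : (forall g x y, k (act g x) (act g y) = k x y) ->
  forall g, GRing.comm (Kmx k d) (P g).
Proof.
move=> inv g; rewrite /GRing.comm /P /Kmx fmx_kmx.
rewrite (kmx_fmx _ (permK (act g)) (permKV (act g))); apply: eq_kmx => x y.
by rewrite -(inv g x) permKV.
Qed.

Let Kmx_idem k d : (0 < d)%N ->
    (forall x z, \sum_y k x y * k y z = d%:Z * k x z) ->
  Kmx k d * Kmx k d = Kmx k d.
Proof.
move=> d0 kk; have d_neq0 : d%:R != 0 :> rat by rewrite pnatr_eq0; lia.
rewrite kmxM; apply: eq_kmx => x z.
transitivity ((\sum_y k x y * k y z)%:~R / (d%:R * d%:R) : rat).
  rewrite rmorph_sum mulr_suml; apply: eq_bigr => y _.
  by rewrite rmorphM /=; field.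
by rewrite kk rmorphM /= -pmulrn; field.
Qed.

Let Kmx_tr k d c g : (0 < d)%N -> (forall h x y, k (act h x) (act h y) = k x y) ->
    \sum_x k (act g x) x = d%:Z * c ->
  \tr (Kmx k d * P g) = c%:~R.
Proof.
move=> d0 inv trk; have d_neq0 : d%:R != 0 :> rat by rewrite pnatr_eq0; lia.
rewrite (Kmx_comm d inv) fmx_kmx mxtrace_kmx -mulr_suml -rmorph_sum /= trk.
by rewrite rmorphM /= -pmulrn mulrC mulKf.
Qed.

Let E20 := Kmx k20 36.
Let E16 := Kmx k16 180.

Local Notation ps k v := (class_sum (even_class chi k%N) v).

Lemma no_unit_order6_of_kernels (u : group_ring int gT) :
  augmentation u = 1 -> u ^+ 6 = 1 -> u ^+ 2 <> 1 -> u ^+ 3 <> 1 -> False.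
Proof.
move=> aug u6 u2 u3.
have [e e01 [a [ps2u ps3u ps2t [c aE]]]] :=
  ps_u chiM even_order order_neq6 aug u6 u2 u3.
have [ps1u ps1s ps1t] := ps_one chiM aug u6 u2 u3.
have [_ ps4s ps4t] := ps_four chiM aug u6.
have [ps5u ps5s ps5t] := ps_five chiM aug u6.
have ps2s := ps_two_s chiM aug u6; have ps3t := ps_three_t chiM aug u6.
have ps3s := ps_three_s chiM even_order aug u6 u2 u3.
pose psE := (ps_mix_norm6 chiM, ps_norm6 chiM aug u6, ps_alt_norm6 chiM aug u6).
have char20E f : even_char chi char20 f = 20 * ps 1 f - 4 * ps 2 f + 2 * ps 3 f.
  by rewrite /even_char (sum6 (fun k => char20 k * ps k f)) /char20 /=; ring.
have char16E f : even_char chi char16 f = 16 * ps 1 f - 2 * ps 3 f + ps 5 f.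
  by rewrite /even_char (sum6 (fun k => char16 k * ps k f)) /char16 /=; ring.
have rank20 := even_rank chiM even_order P1 PM (Kmx_comm 36 k20_act)
  (Kmx_idem (ltn0Sn _) k20_sqr) (fun g cg => Kmx_tr (ltn0Sn _) k20_act (k20_tr cg)).
have rank16 := even_rank chiM even_order P1 PM (Kmx_comm 180 k16_act)
  (Kmx_idem (ltn0Sn _) k16_sqr) (fun g cg => Kmx_tr (ltn0Sn _) k16_act (k16_tr cg)).
have [k0 k0E _] := rank20 _ _ (ltn0Sn 5) (sqr_norm6 u6).
have [k3 k3E _] := rank20 _ _ (ltn0Sn 5) (sqr_alt_norm6 u6).
have [k2 k2E mix0] := rank20 _ _ (ltn0Sn 5) (sqr_mix_norm6 u6).
have [l0 l0E norm0] := rank16 _ _ (ltn0Sn 5) (sqr_norm6 u6).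
rewrite char20E !psE ps1u ps1s ps1t ps2u ps2s ps2t ps3u ps3s ps3t /= in k0E.
rewrite char20E !psE ps1u ps1s ps1t ps2u ps2s ps2t ps3u ps3s ps3t /= in k3E.
rewrite char20E !psE ps1u ps1s ps1t ps2u ps2s ps2t ps3u ps3s ps3t /= in k2E.
rewrite char16E !psE ps1u ps1s ps1t ps3u ps3s ps3t ps5u ps5s ps5t /= in l0E.
(* The equations read k0 = 8 - 4a, k3 = 8 + 4a, k2 = 12 - 4e + 4a and 3 l0 = 12 - 4e + 4a. So a - e
   is odd, divisible by 3 and at least -3, with a between -2 and 2; this leaves one solution, and
   there k2 = l0 = 0. *)
have [eE aE'] : e = 1 /\ a = -2.
  by case: e01 => eE; move: aE k0E k3E k2E l0E; rewrite eE;
    rewrite ?mul0rn ?mulr0n ?mulr1n; lia.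
rewrite eE aE' in k2E l0E ps2t.
have {mix0}[mixP mixP'] := mix0 ltac:(lia).
have {norm0}[normP normP'] := norm0 ltac:(lia).
pose J i x : int := \sum_y k20 x y * F i y.
have F_fix i : (E20 + E16) *m cmx (fun x => (F i x)%:~R) = cmx (fun x => (F i x)%:~R).
  rewrite mulmxDl !kmx_cmx; apply/colP => j; rewrite !mxE -big_split /=.
  set x := enum_val j; transitivity ((180 * F i x)%:~R / 180 : rat); last first.
    by rewrite rmorphM /=; field.
  rewrite -F_sum rmorph_sum mulr_suml; apply: eq_bigr => y _.
  by rewrite !(rmorphM, rmorphD) /=; field.
have F_J i : E20 *m cmx (fun x => (F i x)%:~R) = 36^-1 *: cmx (fun x => (J i x)%:~R).
  rewrite kmx_cmx; apply/colP => j; rewrite !mxE rmorph_sum mulr_sumr.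
  by apply: eq_bigr => y _; rewrite rmorphM /=; field.
(* F is fixed by E20 + E16. [normQ] removes E16, [mixQ] replaces [norm6 u] by 3 (1 + u^3) in front
   of E20, and 12 * 3 / 36 = 1. *)
have col_eq (Q : gT -> 'M[rat]_#|T|) i :
    (forall g, GRing.comm E20 (Q g)) -> (forall g, GRing.comm E16 (Q g)) ->
    E20 * rep Q (mix_norm6 u) = 0 -> E16 * rep Q (norm6 u) = 0 ->
  12 *: (rep Q (norm6 u) *m cmx (fun x => (F i x)%:~R)) =
  rep Q (1 + u ^+ 3) *m cmx (fun x => (J i x)%:~R).
  move=> c20 c16 mixQ normQ; rewrite -[in LHS]F_fix mulmxA.
  have -> : rep Q (norm6 u) *m (E20 + E16) = 3 *: (rep Q (1 + u ^+ 3) *m E20).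
    rewrite !mulmxE mulrDr -(commr_rep _ c20) -(commr_rep _ c16) normQ addr0.
    rewrite -(commr_rep _ c20).
    have -> : norm6 u = (1 + u ^+ 3) *+ 3 - mix_norm6 u.
      by rewrite /mix_norm6 opprB addrC subrK.
    by rewrite repD repN repMn mulrDr mulrN mixQ oppr0 addr0 mulrnAr -scaler_nat commr_rep.
  by rewrite -scalemxAl -mulmxA F_J -scalemxAr !scalerA -[_ * _ * _]/(1 : rat) scale1r.
have colP_act (Q : gT -> 'M[rat]_#|T|) s v (G : T -> rat) x :
    (forall g, Q g = (s g)%:~R *: P g) ->
  (rep Q v *m cmx G) (enum_rank x) 0 =
  \sum_g (coef v g * s g)%:~R * G (act g x).
  move=> Qs; rewrite /rep mulmx_suml summxE; apply: eq_bigr => g _.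
  by rewrite Qs scalerA -scalemxAl fmx_cmx !mxE enum_rankK /= rmorphM.
have twisted_eq i x (s : gT -> int) (Q : gT -> 'M[rat]_#|T|) :
    (forall g, Q g = (s g)%:~R *: P g) ->
    E20 * rep Q (mix_norm6 u) = 0 -> E16 * rep Q (norm6 u) = 0 ->
  12 * (\sum_g coef (norm6 u) g * s g * F i (act g x)) =
  \sum_g coef (1 + u ^+ 3) g * s g * J i (act g x).
  move=> Qs mixQ normQ.
  have cQ k d : (forall g x y, k (act g x) (act g y) = k x y) ->
      forall g, GRing.comm (Kmx k d) (Q g).
    by move=> inv g; rewrite Qs /GRing.comm !scalemxM Kmx_comm.
  have := col_eq Q i (cQ _ _ k20_act) (cQ _ _ k16_act) mixQ normQ.
  move=> /matrixP /(_ (enum_rank x) 0); rewrite mxE !(colP_act Q s) // => eq_rat.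
  apply: (@intr_inj rat); rewrite rmorphM !rmorph_sum /=.
  by under eq_bigr do rewrite rmorphM; under [RHS]eq_bigr do rewrite rmorphM.
have even_sum (f1 f2 : gT -> int) :
    \sum_g f1 g * 1 * f2 g + \sum_g f1 g * sgn_chi chi g * f2 g =
    2 * \sum_(g | ~~ chi g) f1 g * f2 g.
  rewrite -big_split /= (bigID chi) /= [X in X + _]big1 ?add0r => [|g cg]; last first.
    by rewrite /sgn_chi cg; ring.
  rewrite mulr_sumr; apply: eq_bigr => g /negPf cg.
  by rewrite /sgn_chi cg; ring.
(* Adding the equations for [P] and its twist keeps only the elements of A6. *)
have even_eq i x : 12 * (\sum_(g | ~~ chi g) coef (norm6 u) g * F i (act g x)) =
    \sum_(g | ~~ chi g) coef (1 + u ^+ 3) g * J i (act g x).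
  have := twisted_eq i x (fun=> 1) P _ mixP normP.
  move=> /(_ (fun g => esym (scale1r _))).
  have := twisted_eq i x (sgn_chi chi) (twist chi P) (fun=> erefl) mixP' normP'.
  have := even_sum (coef (norm6 u)) (fun g => F i (act g x)).
  have := even_sum (coef (1 + u ^+ 3)) (fun g => J i (act g x)).
  move=> e1 e2 e3 e4; apply: (mulfI (isT : 2 != 0 :> int)).
  by rewrite mulrCA -e2 mulrDr e3 e4 -e1.
(* Modulo 3 and up to sign, psi g is the trace of g on the common             *)
(* 6-dimensional reduction of the images of k20 and k16.                      *)
pose psi g := \sum_i J i (act g (pt i)).
have psi_sum : \sum_(g | ~~ chi g) coef (1 + u ^+ 3) g * psi g =
    12 * \sum_i \sum_(g | ~~ chi g) coef (norm6 u) g * F i (act g (pt i)).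
  rewrite mulr_sumr; under [RHS]eq_bigr do rewrite even_eq.
  rewrite exchange_big; apply: eq_bigr => g _.
  by rewrite mulr_sumr.
have psi_char : (3 %| \sum_(g | ~~ chi g) coef (1 + u ^+ 3) g * (psi g - char6 #[g]%g))%Z.
  apply: rpred_sum => g cg; apply: dvdz_mull.
  by have [z] := F_tr cg; rewrite -/(psi g) => ->; rewrite addrC addKr dvdz_mulr.
(* Of all the class sums only [ps 2 (u ^+ 3)] = 1 contributes. *)
have char_sum6 : \sum_(g | ~~ chi g) coef (1 + u ^+ 3) g * char6 #[g]%g = -1.
  rewrite (sum_even_class even_order _ (c := char6)) // (sum6 (fun k => char6 k * ps k _)).
  rewrite /char6 /= !class_sumD !even_class_one // ps2t ps4t ps5t /=.
  by ring.
move: psi_char; under eq_bigr do rewrite mulrBr.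
rewrite sumrB char_sum6 psi_sum; lia.
Qed.

End Contradiction.

(** * The conference matrix on the projective line and the kernels on pairs *)

Definition quad (x : F9) : int :=
  if x == 0 then 0 else if is_square x then 1 else -1.

Lemma quadM x y : quad (x * y) = quad x * quad y.
Proof.
rewrite /quad mulf_eq0; case: eqP => [|/eqP x0]; first by rewrite mul0r.
case: eqP => [|/eqP y0]; first by rewrite mulr0.
by rewrite is_squareM //; case: (is_square x); case: (is_square y).
Qed.

Lemma quad_sqr x : x != 0 -> quad x * quad x = 1.
Proof. by rewrite /quad => /negPf ->; case: ifP. Qed.

Lemma F9_sqrtN1 : exists i : F9, i ^+ 2 = -1.
Proof.
have [g [g8 gdvd _]] := F9_generator; exists (g ^+ 2).
apply/eqP; rewrite -exprM -addr_eq0 -[_ == 0]orbF.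
have g41 : g ^+ 4 - 1 != 0.
  by rewrite subr_eq0; apply/eqP => /gdvd.
by rewrite -(negbTE g41) -mulf_eq0 mulrC -subr_sqr expr1n -exprM g8 subrr.
Qed.

Lemma quadN x : quad (- x) = quad x.
Proof.
rewrite -mulN1r quadM; suff -> : quad (-1) = 1 by rewrite mul1r.
have [i iE] := F9_sqrtN1; rewrite /quad oppr_eq0 oner_eq0.
by case: is_squareP => // -[]; exists i.
Qed.

Lemma quad_twist E x : quad (M10_twist E x) = quad x.
Proof.
rewrite /quad M10_twist_eq0; case: eqP => // /eqP x0.
by rewrite is_square_twist.
Qed.

Local Notation P1 := (option F9).

Definition det2 (p q : P1) : F9 :=
  (homog_coord p).1 * (homog_coord q).2 - (homog_coord p).2 * (homog_coord q).1.

(* A conference matrix of order 10: its square is 9. *)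
Definition conf (p q : P1) : int := quad (det2 p q).

(** The scalar that [homog_point] divides out. *)
Definition homog_scale (x y : F9) : F9 := if y == 0 then x else y.

Lemma homog_scaleP (x y : F9) : (x != 0) || (y != 0) ->
  [/\ homog_scale x y != 0,
      x = homog_scale x y * (homog_coord (homog_point x y)).1 &
      y = homog_scale x y * (homog_coord (homog_point x y)).2].
Proof.
rewrite /homog_scale /homog_point; case: (y =P 0) => [-> |/eqP y0 _] /=.
  by rewrite orbF => x0; split; rewrite ?mulr1 ?mulr0.
by split; rewrite ?mulr1 // mulrC divfK.
Qed.

(** s preserves the conference matrix up to signs k on rows and columns and a global sign e. *)
Definition switching (e : int) (s : {perm P1}) : Prop :=
  e * e = 1 /\ exists2 k : P1 -> int, forall p, k p * k p = 1
    & forall p q, conf (s p) (s q) = e * k p * k q * conf p q.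

(** Up to the scalars k, [det2] of two images is the determinant times the twisted [det2]; the
    quadratic character is multiplicative and unchanged by cubing. *)
Lemma switching_frac E a b c d (s : {perm P1}) : a * d - b * c != 0 ->
    s =1 semilinear_frac (M10_twist E) a b c d ->
  switching (quad (a * d - b * c)) s.
Proof.
move=> D0 sE; split; first exact: quad_sqr.
pose f := M10_twist E.
pose X p := a * f (homog_coord p).1 + b * f (homog_coord p).2.
pose Y p := c * f (homog_coord p).1 + d * f (homog_coord p).2.
have XY0 p : (X p != 0) || (Y p != 0).
  by apply: det2_neq0 => //; rewrite !M10_twist_eq0 homog_coord_neq0.
have sXY p : s p = homog_point (X p) (Y p).
  by rewrite sE /semilinear_frac (surjective_pairing (homog_coord p)).
pose k p := homog_scale (X p) (Y p).
exists (fun p => quad (k p)) => [p|p q].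
  by have [k0 _ _] := homog_scaleP (XY0 p); exact: quad_sqr.
have coordE r : X r = k r * (homog_coord (s r)).1 /\ Y r = k r * (homog_coord (s r)).2.
  by have [_ Xr Yr] := homog_scaleP (XY0 r); rewrite sXY.
have detE : k p * k q * det2 (s p) (s q) = (a * d - b * c) * f (det2 p q).
  transitivity (X p * Y q - Y p * X q).
    have [-> ->] := coordE p; have [-> ->] := coordE q.
    by rewrite /det2; ring.
  by rewrite /X /Y /f /det2 M10_twistD M10_twistN !M10_twistM; ring.
have := congr1 quad detE; rewrite !quadM quad_twist -!/(conf _ _) => qE.
have k1 r : quad (k r) * quad (k r) = 1.
  by have [k0 _ _] := homog_scaleP (XY0 r); exact: quad_sqr.
transitivity (quad (k p) * quad (k p) * (quad (k q) * quad (k q)) * conf (s p) (s q)).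
  by rewrite !k1 !mul1r.
transitivity (quad (k p) * quad (k q) * (quad (k p) * quad (k q) * conf (s p) (s q))).
  by ring.
by rewrite qE; ring.
Qed.

(* The product of conf around the 4-cycle x, y, w, z does not depend on the   *)
(* choice of homogeneous coordinates.                                         *)
Definition cycle4 (x y z w : P1) : int :=
  conf x y * conf y w * conf w z * conf z x.

Definition cycle3 (x y z : P1) : int := conf x y * conf y z * conf z x.

Lemma switching_cycle4 e s x y z w : switching e s ->
  cycle4 (s x) (s y) (s z) (s w) = cycle4 x y z w.
Proof.
move=> [e2 [k k2 sE]]; rewrite /cycle4 !sE.
transitivity ((e * e) * (e * e) * (k x * k x) * (k y * k y) * (k z * k z) *
  (k w * k w) * (conf x y * conf y w * conf w z * conf z x)); first by ring.
by rewrite !k2 !e2 !mul1r.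
Qed.

Lemma switching_cycle3 e s x y z : switching e s ->
  cycle3 (s x) (s y) (s z) = e * cycle3 x y z.
Proof.
move=> [e2 [k k2 sE]]; rewrite /cycle3 !sE.
transitivity ((e * e) * (k x * k x) * (k y * k y) * (k z * k z) *
  (e * (conf x y * conf y z * conf z x))); first by ring.
by rewrite !k2 !e2 !mul1r.
Qed.

(** Recovers the global sign of a switching; for a fractional map it is the quadratic character of
    the determinant, whichever matrix represents the map. *)
Definition tau (s : {perm P1}) : int :=
  cycle3 (s None) (s (Some 0)) (s (Some 1)) * cycle3 None (Some 0) (Some 1).

Lemma switching_tau e s : switching e s -> tau s = e.
Proof.
move=> sw; rewrite /tau (switching_cycle3 _ _ _ sw) /cycle3 /conf /det2 /=.
rewrite !(mul0r, mulr0, mul1r, mulr1, add0r, addr0, subr0, sub0r) !quadN.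
have -> : quad 1 = 1.
  by rewrite /quad oner_eq0; case: is_squareP => // -[]; exists 1; rewrite expr1n.
by rewrite !mulr1.
Qed.

Lemma switchingM e e' s s' : switching e s -> switching e' s' ->
  switching (e * e') (s * s')%g.
Proof.
move=> [e2 [k k2 sE]] [e2' [k' k2' sE']]; split.
  by rewrite mulrACA e2 e2' mulr1.
exists (fun p => k p * k' (s p)) => [p|p q]; first by rewrite mulrACA k2 k2' mulr1.
by rewrite !permM sE' sE; ring.
Qed.

Definition delta (p q : P1) : int := (p == q)%:R.

Local Notation T := (P1 * P1)%type.

Definition alt_ker (p q : T) : int :=
  delta p.1 q.1 * delta p.2 q.2 - delta p.1 q.2 * delta p.2 q.1.

(* Up to the factors 36, 20 and 180, ker20, ker9 and ker16 are the            *)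
(* projections onto the components of degrees 10 + 10, 9 and 8 + 8 of the     *)
(* alternating functions of two points.                                       *)
Definition ker20 (p q : T) : int :=
  9 * alt_ker p q + (cycle4 p.1 p.2 q.1 q.2 - cycle4 p.1 p.2 q.2 q.1).

Definition ker9 (p q : T) : int :=
  delta p.1 q.1 - delta p.2 q.1 - delta p.1 q.2 + delta p.2 q.2.

Definition ker16 (p q : T) : int := 90 * alt_ker p q - 5 * ker20 p q - 9 * ker9 p q.

Definition pair_fun (s : {perm P1}) (p : T) : T := (s p.1, s p.2).

Lemma pair_fun_inj s : injective (pair_fun s).
Proof. by move=> [x y] [z w] [/perm_inj -> /perm_inj ->]. Qed.

Definition pair_perm s : {perm T} := perm (@pair_fun_inj s).

Lemma pair_permM s t : pair_perm (s * t)%g = (pair_perm s * pair_perm t)%g.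
Proof. by apply/permP => p; rewrite !permE /= !permE /pair_fun /= !permM. Qed.

Lemma delta_perm (s : {perm P1}) p q : delta (s p) (s q) = delta p q.
Proof. by rewrite /delta (inj_eq perm_inj). Qed.

Lemma ker20_perm e s p q : switching e s ->
  ker20 (pair_perm s p) (pair_perm s q) = ker20 p q.
Proof.
by move=> sw; rewrite /ker20 /alt_ker !permE /= !delta_perm !(switching_cycle4 _ _ _ _ sw).
Qed.

Lemma ker16_perm e s p q : switching e s ->
  ker16 (pair_perm s p) (pair_perm s q) = ker16 p q.
Proof.
move=> sw; rewrite /ker16 (ker20_perm _ _ sw) /ker9 /alt_ker !permE /=.
by rewrite !delta_perm.
Qed.

(** * Computation in F9 with coded elements *)

(* The number 3 a + b < 9 encodes a + b i in F9 = F3[i], and 9 encodes the    *)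
(* point at infinity.                                                         *)
Definition re9 (x : nat) : nat := (x %/ 3)%N.
Definition im9 (x : nat) : nat := (x %% 3)%N.
Definition add9 (x y : nat) : nat :=
  (3 * ((re9 x + re9 y) %% 3) + (im9 x + im9 y) %% 3)%N.
Definition mul9 (x y : nat) : nat :=
  (3 * ((re9 x * re9 y + 2 * (im9 x * im9 y)) %% 3) +
   (re9 x * im9 y + im9 x * re9 y) %% 3)%N.
Definition inv9 (x : nat) : nat := nth 0 [:: 0; 2; 1; 3; 7; 8; 6; 4; 5]%N x.
Definition square9 (x : nat) : bool := has (fun y => mul9 y y == x) (iota 0 9).

(** The codes 3 and 6 stand for 1 and -1. *)
Definition coord9 (p : nat) : nat * nat := if (p < 9)%N then (p, 3)%N else (3, 0)%N.
Definition point9 (x y : nat) : nat := if y == 0%N then 9 else mul9 x (inv9 y).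
Definition twist9 (t : bool) (x : nat) : nat := if t then mul9 x (mul9 x x) else x.
Definition det9 (a b c d : nat) : nat := add9 (mul9 a d) (mul9 6 (mul9 b c)).
Definition frac9 (t : bool) (a b c d p : nat) : nat :=
  let x := twist9 t (coord9 p).1 in let y := twist9 t (coord9 p).2 in
  point9 (add9 (mul9 a x) (mul9 b y)) (add9 (mul9 c x) (mul9 d y)).
Definition quad9 (x : nat) : int :=
  if x == 0%N then 0 else if square9 x then 1 else -1.

Section Decoding.
Variable i0 : F9.
Hypothesis i0_sqr : i0 ^+ 2 = -1.

Definition dec (x : nat) : F9 := (re9 x)%:R + (im9 x)%:R * i0.

Lemma mod3F (n : nat) : (n %% 3)%:R = n%:R :> F9.
Proof. exact: (GRing.natr_mod_pchar pchar_F9 n). Qed.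

Lemma re9E a b : (b < 3)%N -> re9 (3 * a + b) = a.
Proof. by rewrite /re9; lia. Qed.

Lemma im9E a b : (b < 3)%N -> im9 (3 * a + b) = b.
Proof. by rewrite /im9; lia. Qed.

Lemma dec_add x y : dec (add9 x y) = dec x + dec y.
Proof.
rewrite /dec /add9 re9E ?im9E ?ltn_mod // !(mod3F (_ + _)) !natrD; ring.
Qed.

Lemma dec_mul x y : dec (mul9 x y) = dec x * dec y.
Proof.
rewrite /dec /mul9 re9E ?im9E ?ltn_mod // !(mod3F (_ + _)) !natrD !natrM.
(* The coefficient 2 in [mul9] is -1 = i0^2 in characteristic 3. *)
have two (z : F9) : z + (z + 0) = i0 ^+ 2 * z.
  rewrite addr0 i0_sqr mulN1r; apply/eqP; rewrite -addr_eq0.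
  by have := mulrn_pchar pchar_F9 z; rewrite mulrSr mulr2n => ->.
rewrite two; ring.
Qed.

Lemma dec3 : dec 3 = 1. Proof. by rewrite /dec /= mul0r addr0. Qed.
Lemma dec0 : dec 0 = 0. Proof. by rewrite /dec /= mul0r addr0. Qed.
Lemma dec6 : dec 6 = -1.
Proof.
rewrite /dec mul0r addr0; apply/eqP; rewrite -addr_eq0 -[1]/(1%:R) -natrD.
by rewrite (pcharf0 pchar_F9).
Qed.

Lemma all_iotaP (P : pred nat) n : all P (iota 0 n) -> forall k, (k < n)%N -> P k.
Proof. by move=> /allP H k kn; apply: H; rewrite mem_iota. Qed.

Lemma dec_inv x : (0 < x < 9)%N -> dec x != 0 /\ dec (inv9 x) = (dec x)^-1.
Proof.
move=> /andP[x0 x9]; have xV : dec x * dec (inv9 x) = 1.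
  rewrite -dec_mul -dec3; congr dec; apply/eqP.
  have /all_iotaP/(_ x x9) : all (fun x => (0 < x)%N ==> (mul9 x (inv9 x) == 3%N)) (iota 0 9).
    by [].
  by rewrite x0.
have x_neq0 : dec x != 0.
  by apply: contra_eq_neq xV => ->; rewrite mul0r eq_sym oner_eq0.
by split=> //; apply: (mulfI x_neq0); rewrite xV divff.
Qed.

Lemma dec_eq0 x : (x < 9)%N -> (dec x == 0) = (x == 0%N).
Proof.
case: (posnP x) => [-> _|x0 x9]; first by rewrite dec0 !eqxx.
by have [/negPf -> _] := dec_inv (introT andP (conj x0 x9)).
Qed.

Lemma add9_lt x y : (add9 x y < 9)%N.
Proof. by rewrite /add9; lia. Qed.

Lemma mul9_lt x y : (mul9 x y < 9)%N.
Proof. by rewrite /mul9; lia. Qed.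

Lemma dec9_inj x y : (x < 9)%N -> (y < 9)%N -> dec x = dec y -> x = y.
Proof.
move=> x9 y9 xy; have : dec (add9 x (mul9 6 y)) == 0.
  by rewrite dec_add dec_mul dec6 xy mulN1r subrr.
rewrite dec_eq0 ?add9_lt // => xy0; apply/eqP; move: xy0; apply/implyP.
have /all_iotaP/(_ x x9)/all_iotaP/(_ y y9) // : all (fun x => all (fun y =>
  (add9 x (mul9 6 y) == 0%N) ==> (x == y)) (iota 0 9)) (iota 0 9).
by [].
Qed.

Lemma dec_surj (z : F9) : exists2 x, (x < 9)%N & z = dec x.
Proof.
have inj : injective (fun x : 'I_9 => dec x).
  by move=> x y /dec9_inj xy; apply: val_inj; apply: xy.
have [|h _ hK] := inj_card_bij inj; first by rewrite card_F9 card_ord.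
by exists (h z); rewrite ?hK ?ltn_ord.
Qed.

Lemma is_square_dec x : (x < 9)%N -> is_square (dec x) = square9 x.
Proof.
move=> x9; apply/is_squareP/hasP => [[z xz]|[y]].
  have [y y9 zE] := dec_surj z; exists y; first by rewrite mem_iota.
  apply/eqP; apply: dec9_inj; rewrite ?mul9_lt //.
  by rewrite dec_mul xz zE expr2.
by rewrite mem_iota => _ /eqP <-; exists (dec y); rewrite dec_mul expr2.
Qed.

Lemma quad_dec x : (x < 9)%N -> quad (dec x) = quad9 x.
Proof. by move=> x9; rewrite /quad /quad9 dec_eq0 ?is_square_dec. Qed.

Definition pt (k : nat) : option F9 := if (k < 9)%N then Some (dec k) else None.

Lemma coord_pt k : (k < 10)%N ->
  homog_coord (pt k) = (dec (coord9 k).1, dec (coord9 k).2).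
Proof.
by move=> k10; rewrite /pt /coord9; case: ifP => _ /=; rewrite ?dec3 ?dec0.
Qed.

Lemma point_dec x y : (x < 9)%N -> (y < 9)%N ->
  homog_point (dec x) (dec y) = pt (point9 x y).
Proof.
move=> x9 y9; rewrite /homog_point /point9 dec_eq0 //.
case: (posnP y) => [_|y0] //; rewrite /pt mul9_lt dec_mul.
by have [_ ->] := dec_inv (introT andP (conj y0 y9)).
Qed.

Lemma frac_dec (t : bool) E a b c d k : (a < 9)%N -> (b < 9)%N -> (c < 9)%N -> (d < 9)%N ->
    (k < 10)%N -> is_square E = ~~ t ->
  semilinear_frac (M10_twist E) (dec a) (dec b) (dec c) (dec d) (pt k) =
  pt (frac9 t a b c d k).
Proof.
move=> a9 b9 c9 d9 k10 Et; rewrite /semilinear_frac coord_pt //.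
have tw x : M10_twist E (dec x) = dec (twist9 t x).
  by rewrite /M10_twist /twist9 Et; case: t {Et} => //=; rewrite !dec_mul.
by rewrite !tw -!dec_mul -!dec_add point_dec ?add9_lt.
Qed.

Lemma pt_inj : {in gtn 10 &, injective pt}.
Proof.
move=> x y; rewrite !inE /pt => x10 y10.
case: ltnP => x9; case: ltnP => y9 //; last by lia.
by move=> [] /dec9_inj; apply.
Qed.

Lemma pt_surj (p : option F9) : exists2 k, (k < 10)%N & p = pt k.
Proof.
case: p => [z|]; last by exists 9%N.
have [x x9 ->] := dec_surj z; exists x; first exact: leqW.
by rewrite /pt x9.
Qed.

Definition sum10 (G : nat -> int) : int := foldr (fun k s => G k + s) 0 (iota 0 10).

Lemma eq_sum10 G H : (forall k, (k < 10)%N -> G k = H k) -> sum10 G = sum10 H.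
Proof.
move=> GH; rewrite /sum10; have : all (gtn 10) (iota 0 10) by [].
by elim: (iota 0 10) => //= k s IH /andP[k10 /IH ->]; rewrite GH.
Qed.

Lemma sum_P1 (G : option F9 -> int) : \sum_p G p = sum10 (fun k => G (pt k)).
Proof.
have inj : injective (fun k : 'I_10 => pt k).
  by move=> x y /pt_inj xy; apply: val_inj; apply: xy; rewrite inE.
have bij : bijective (fun k : 'I_10 => pt k).
  by apply: inj_card_bij inj _; rewrite card_option card_F9 card_ord.
rewrite (reindex _ (onW_bij _ bij)) /= -(big_mkord xpredT (fun k => G (pt k))).
rewrite /index_iota subn0 /sum10.
by elim: (iota 0 10) => [|k s IH]; rewrite ?big_nil // big_cons IH.
Qed.

Lemma sum_pairs (G : option F9 * option F9 -> int) :
  \sum_p G p = sum10 (fun a => sum10 (fun b => G (pt a, pt b))).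
Proof.
transitivity (\sum_(p : option F9) \sum_(q : option F9) G (p, q)).
  by rewrite pair_big; apply: eq_bigr => -[].
by rewrite sum_P1; apply: eq_sum10 => a _; rewrite sum_P1.
Qed.

End Decoding.

(** * Triangles and the idempotent identities *)

Lemma sum_alt_ker (G : T -> int) (q : T) :
  \sum_p G p * alt_ker p q = G q - G (q.2, q.1).
Proof.
have pick (r : T) : \sum_p G p * (delta p.1 r.1 * delta p.2 r.2) = G r.
  rewrite (bigD1 r) //= /delta !eqxx !mulr1 big1 ?addr0 // => -[x y].
  by case: r => z w; rewrite xpair_eqE /=; case: eqP; case: eqP => //; rewrite !(mulr0, mul0r).
rewrite /alt_ker; under eq_bigr do rewrite mulrBr.
by rewrite sumrB (pick q) (pick (q.2, q.1)).
Qed.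

Definition triangle (a b c : P1) (p : T) : int :=
  alt_ker p (a, b) + alt_ker p (b, c) + alt_ker p (c, a).

Lemma sum_triangle (G : T -> int) a b c :
  \sum_p G p * triangle a b c p =
  G (a, b) - G (b, a) + (G (b, c) - G (c, b)) + (G (c, a) - G (a, c)).
Proof.
transitivity (\sum_p (G p * alt_ker p (a, b) + G p * alt_ker p (b, c) + G p * alt_ker p (c, a))).
  by apply: eq_bigr => p _; rewrite /triangle; ring.
by rewrite big_split big_split /= !sum_alt_ker.
Qed.

(** 5 [ker20] + [ker16] is 90 [alt_ker] - 9 [ker9]. A triangle is a cycle, hence killed by [ker9],
    and [alt_ker] is 2 on alternating functions. *)
Lemma ker_sum_triangle a b c p :
  \sum_q (5 * ker20 p q + ker16 p q) * triangle a b c q = 180 * triangle a b c p.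
Proof.
rewrite sum_triangle /triangle /ker16 /ker9 /alt_ker /=.
by ring.
Qed.

Lemma ker20_sum_triangle a b c p :
  \sum_q ker20 p q * triangle a b c q =
  2 * (ker20 p (a, b) + ker20 p (b, c) + ker20 p (c, a)).
Proof. by rewrite sum_triangle /ker20 /alt_ker /=; ring. Qed.

Lemma conf_diag p : conf p p = 0.
Proof. by rewrite /conf /det2 mulrC subrr /quad eqxx. Qed.

Lemma ker20_diag p q : ker20 (p, p) q = 0.
Proof. by rewrite /ker20 /alt_ker /cycle4 /= conf_diag; ring. Qed.

Lemma ker16_diag p q : ker16 (p, p) q = 0.
Proof. by rewrite /ker16 ker20_diag /ker9 /alt_ker /=; ring. Qed.

Lemma det2_eq0 p q : (det2 p q == 0) = (p == q).
Proof.
rewrite /det2; case: p q => [x|] [y|] /=.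
- by rewrite mulr1 mul1r subr_eq0.
- by rewrite mulr0 sub0r mulr1 oppr_eq0 oner_eq0.
- by rewrite mulr1 mul0r subr0 oner_eq0.
- by rewrite mulr0 mul0r subrr !eqxx.
Qed.

Lemma semilinear_fracE f a b c d p :
  semilinear_frac f a b c d p =
  homog_point (a * f (homog_coord p).1 + b * f (homog_coord p).2)
              (c * f (homog_coord p).1 + d * f (homog_coord p).2).
Proof. by rewrite /semilinear_frac; case: (homog_coord p). Qed.

Lemma semilinear_frac_inj E a b c d : a * d - b * c != 0 ->
  injective (semilinear_frac (M10_twist E) a b c d).
Proof.
move=> D0 p q pq; apply/eqP; rewrite -det2_eq0; move: pq.
rewrite !semilinear_fracE.
set f := M10_twist E; set X := a * _ + _; set Y := c * _ + _.
set X' := a * _ + _; set Y' := c * _ + _ => pq.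
have XY0 : (X != 0) || (Y != 0).
  by apply: det2_neq0 => //; rewrite !M10_twist_eq0 homog_coord_neq0.
have XY0' : (X' != 0) || (Y' != 0).
  by apply: det2_neq0 => //; rewrite !M10_twist_eq0 homog_coord_neq0.
have [_ XE YE] := homog_scaleP XY0; have [_ XE' YE'] := homog_scaleP XY0'.
have : (a * d - b * c) * f (det2 p q) = 0.
  transitivity (X * Y' - Y * X').
    by rewrite /X /Y /X' /Y' /f /det2 M10_twistD M10_twistN !M10_twistM; ring.
  move: XE YE XE' YE'; rewrite pq; set P := homog_point _ _.
  set k := homog_scale X Y; set k' := homog_scale X' Y' => -> -> -> ->.
  by ring.
by move/eqP; rewrite mulf_eq0 (negPf D0) M10_twist_eq0.
Qed.

Definition frac_perm E a b c d (D0 : a * d - b * c != 0) : {perm P1} :=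
  perm (@semilinear_frac_inj E a b c d D0).

Lemma switching_frac_perm E a b c d (D0 : a * d - b * c != 0) :
  switching (quad (a * d - b * c)) (frac_perm E D0).
Proof. by apply: (@switching_frac E) => // p; rewrite permE. Qed.

(** The map x -> (det2 x q : det2 p x) sends p to infinity and q to 0. *)
Lemma two_transitive p q : p != q -> exists e, exists2 s, switching e s
  & s p = None /\ s q = Some 0.
Proof.
rewrite -det2_eq0 => pq.
have D0 : (homog_coord q).2 * (homog_coord p).1 -
    - (homog_coord q).1 * - (homog_coord p).2 != 0.
  by move: pq; apply: contra_neq => D0; rewrite -D0 /det2; ring.
have E1 : M10_twist 1 =1 id.
  by move=> x; rewrite /M10_twist; case: is_squareP => // -[]; exists 1; rewrite expr1n.
eexists; exists (frac_perm 1 D0); first exact: switching_frac_perm.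
rewrite !permE !semilinear_fracE !E1; split.
  by rewrite [X in homog_point _ X](_ : _ = 0) ?/homog_point ?eqxx //; ring.
rewrite [X in homog_point X _](_ : _ = 0); last by ring.
rewrite /homog_point mul0r; case: eqP => // Y0; case/eqP: D0.
by rewrite -[RHS]Y0; ring.
Qed.

(** By two-transitivity a single row of the kernel has to be checked. *)
Lemma ker_sqr (k : T -> T -> int) (d : int) :
    (forall e s p q, switching e s -> k (pair_perm s p) (pair_perm s q) = k p q) ->
    (forall p q, k (p, p) q = 0) ->
    (forall r, \sum_q k (None, Some 0) q * k q r = d * k (None, Some 0) r) ->
  forall p r, \sum_q k p q * k q r = d * k p r.
Proof.
move=> inv diag base [x y] r; case: (eqVneq x y) => [->|xy].
  by rewrite diag mulr0 big1 // => q _; rewrite diag mul0r.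
have [e [s sw [sx sy]]] := two_transitive xy.
have sp : pair_perm s (x, y) = (None, Some 0) by rewrite permE /pair_fun /= sx sy.
rewrite -(inv _ _ _ r sw) sp -base [RHS](reindex_inj (@perm_inj _ (pair_perm s))) /=.
by apply: eq_bigr => q _; rewrite -sp !(inv _ _ _ _ sw).
Qed.

(** * Tables and their verification for all fractional maps *)

Definition conf_tab : seq (seq int) := Eval vm_compute in
  [seq [seq quad9 (add9 (mul9 (coord9 p).1 (coord9 q).2)
                        (mul9 6 (mul9 (coord9 p).2 (coord9 q).1)))
       | q <- iota 0 10] | p <- iota 0 10].

Definition conf9 (p q : nat) : int := nth 0 (nth [::] conf_tab p) q.

Definition eq9 (a b : nat) : int := if a == b then 1 else 0.

Definition alt9 (a b c d : nat) : int := eq9 a c * eq9 b d - eq9 a d * eq9 b c.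

Definition cycle9 (a b c d : nat) : int :=
  conf9 a b * conf9 b d * conf9 d c * conf9 c a.

Definition ker20_9 (a b c d : nat) : int :=
  9 * alt9 a b c d + (cycle9 a b c d - cycle9 a b d c).

Definition ker9_9 (a b c d : nat) : int := eq9 a c - eq9 b c - eq9 a d + eq9 b d.

Definition ker16_9 (a b c d : nat) : int :=
  90 * alt9 a b c d - 5 * ker20_9 a b c d - 9 * ker9_9 a b c d.

Definition base_sqr (k : nat -> nat -> nat -> nat -> int) (m : int) : bool :=
  all (fun c => all (fun d =>
    sum10 (fun a => sum10 (fun b => k 9%N 0%N a b * k a b c d)) == m * k 9%N 0%N c d)
  (iota 0 10)) (iota 0 10).

Lemma base_sqr20 : base_sqr ker20_9 36.
Proof. by vm_compute. Qed.

Lemma base_sqr16 : base_sqr ker16_9 180.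
Proof. by vm_compute. Qed.

Definition iterates9 (l : seq nat) (k : nat) : bool :=
  all (fun p => iter k (nth 0%N l) p == p) (iota 0 10).

(** The value is 6 when none of the orders 1 to 5 fits. *)
Definition order9 (l : seq nat) : nat :=
  (find (iterates9 l) [:: 1; 2; 3; 4; 5]%N).+1.

Definition probes : seq (nat * nat) :=
  [:: (0, 1); (0, 2); (0, 3); (1, 2); (1, 3); (2, 3)]%N.

Definition triangles : seq (seq (int * (nat * nat * nat))) :=
  [:: [:: (-1, (0, 1, 2)%N); (-1, (0, 1, 3)%N); (1, (0, 1, 4)%N); (1, (0, 2, 3)%N)];
      [:: (-1, (0, 1, 2)%N); (1, (0, 1, 4)%N); (1, (0, 1, 6)%N); (1, (0, 2, 3)%N)];
      [:: (1, (0, 1, 3)%N); (1, (0, 2, 3)%N)];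
      [:: (1, (0, 1, 2)%N); (1, (0, 1, 3)%N); (-1, (0, 2, 3)%N)];
      [:: (1, (0, 1, 3)%N); (-1, (0, 1, 4)%N); (-1, (0, 1, 5)%N); (-1, (0, 2, 3)%N)];
      [:: (1, (0, 1, 3)%N); (-1, (0, 1, 4)%N); (-1, (0, 1, 5)%N); (-1, (0, 1, 6)%N); (1, (0, 2, 3)%N)]].

(* Found by Gaussian elimination: modulo 3 and up to sign, the images under   *)
(* ker20 of these combinations of triangles form the basis dual to the        *)
(* evaluations at the probes.                                                 *)
Definition image9 (i a b : nat) : int :=
  foldr (fun t s => let: (z, (x, y, w)) := t in
    2 * z * (ker20_9 a b x y + ker20_9 a b y w + ker20_9 a b w x) + s) 0
    (nth [::] triangles i).

Definition image_tab : seq (seq (seq int)) := Eval vm_compute in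
  [seq [seq [seq image9 i a b | b <- iota 0 10] | a <- iota 0 10] | i <- iota 0 6].

Definition trace6 (l : seq nat) : int :=
  foldr (fun i s => nth 0 (nth [::] (nth [::] image_tab i)
     (nth 0%N l (nth (0, 0)%N probes i).1)) (nth 0%N l (nth (0, 0)%N probes i).2) + s)
  0 (iota 0 6).

Definition row9 (t : bool) (a b c d : nat) : seq nat :=
  [seq frac9 t a b c d p | p <- iota 0 10].

(** The third test stands for the trace of [ker16]: 9 times the kernel in it is 5 [ker20] +
    [ker16]. *)
Definition even_ok (l : seq nat) : bool :=
  [&& (order9 l <= 5)%N,
   sum10 (fun a => sum10 (fun b => ker20_9 (nth 0%N l a) (nth 0%N l b) a b))
     == 36 * char20 (order9 l),
   sum10 (fun a => sum10 (fun b => 10 * alt9 (nth 0%N l a) (nth 0%N l b) a b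
      - ker9_9 (nth 0%N l a) (nth 0%N l b) a b))
     == 20 * (char20 (order9 l) + char16 (order9 l)) &
   ((trace6 l - char6 (order9 l)) %% 3 == 0)%Z].

Definition odd_ok (l : seq nat) : bool :=
  iterates9 l 6 ==> iterates9 l 2 || iterates9 l 3.

(** In both groups the maps of square determinant are untwisted. For a non-square determinant the
    untwisted map lies in PGL(2,9) and the twisted one in M10. *)
Definition row_ok (a b c d : nat) : bool :=
  if square9 (det9 a b c d) then even_ok (row9 false a b c d)
  else odd_ok (row9 false a b c d) && odd_ok (row9 true a b c d).

(** One matrix for each class modulo scalars, 720 in all: the lower row is (0, 1) or (1, d). *)
Definition all_nonsingular (P : nat -> nat -> nat -> nat -> bool) : bool :=
  all (fun a => all (fun b =>
    ((det9 a b 0 3 == 0%N) || P a b 0%N 3%N) &&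
    all (fun d => (det9 a b 3 d == 0%N) || P a b 3%N d) (iota 0 9))
  (iota 0 9)) (iota 0 9).
Lemma all_row_ok : all_nonsingular row_ok.
Proof. by vm_compute. Qed.

Lemma nonsingularP P : all_nonsingular P -> forall a b c d,
  (a < 9)%N -> (b < 9)%N -> (d < 9)%N -> (c == 0%N) && (d == 3%N) || (c == 3%N) ->
  det9 a b c d != 0%N -> P a b c d.
Proof.
move=> H a b c d a9 b9 d9 cd D0.
have /andP[H1 H2] := all_iotaP (all_iotaP H a9) b9.
case/orP: cd => [/andP[/eqP c0 /eqP d3]|/eqP c3].
  by move: D0 H1; rewrite c0 d3 => /negPf ->.
by have := all_iotaP H2 d9; rewrite -c3 (negPf D0).
Qed.

Section Decoding.
Variable i0 : F9.
Hypothesis i0_sqr : i0 ^+ 2 = -1.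
Local Notation pt := (pt i0).
Local Notation dec := (dec i0).

Lemma conf_pt p q : (p < 10)%N -> (q < 10)%N -> conf (pt p) (pt q) = conf9 p q.
Proof.
move=> p10 q10; rewrite /conf /det2 !coord_pt //=.
rewrite -mulN1r -(dec6 i0) -!dec_mul // -dec_add quad_dec ?add9_lt //.
apply/eqP; move: q q10; apply: all_iotaP; move: p p10; apply: all_iotaP.
by vm_compute.
Qed.

Lemma delta_pt a b : (a < 10)%N -> (b < 10)%N -> delta (pt a) (pt b) = eq9 a b.
Proof.
move=> a10 b10; rewrite /delta /eq9 (inj_in_eq (pt_inj i0_sqr)) ?inE //.
by case: eqP.
Qed.

Lemma alt_ker_pt a b c d : (a < 10)%N -> (b < 10)%N -> (c < 10)%N -> (d < 10)%N ->
  alt_ker (pt a, pt b) (pt c, pt d) = alt9 a b c d.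
Proof. by move=> *; rewrite /alt_ker /alt9 /= !delta_pt. Qed.

Lemma ker9_pt a b c d : (a < 10)%N -> (b < 10)%N -> (c < 10)%N -> (d < 10)%N ->
  ker9 (pt a, pt b) (pt c, pt d) = ker9_9 a b c d.
Proof. by move=> *; rewrite /ker9 /ker9_9 /= !delta_pt. Qed.

Lemma ker20_pt a b c d : (a < 10)%N -> (b < 10)%N -> (c < 10)%N -> (d < 10)%N ->
  ker20 (pt a, pt b) (pt c, pt d) = ker20_9 a b c d.
Proof.
by move=> *; rewrite /ker20 /ker20_9 alt_ker_pt // /cycle4 /cycle9 /= !conf_pt.
Qed.

Lemma ker16_pt a b c d : (a < 10)%N -> (b < 10)%N -> (c < 10)%N -> (d < 10)%N ->
  ker16 (pt a, pt b) (pt c, pt d) = ker16_9 a b c d.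
Proof. by move=> *; rewrite /ker16 /ker16_9 alt_ker_pt // ker20_pt // ker9_pt. Qed.

Lemma ker_sqr9 (k : T -> T -> int) (k9 : nat -> nat -> nat -> nat -> int) m :
    (forall e s p q, switching e s -> k (pair_perm s p) (pair_perm s q) = k p q) ->
    (forall p q, k (p, p) q = 0) ->
    (forall a b c d, (a < 10)%N -> (b < 10)%N -> (c < 10)%N -> (d < 10)%N ->
      k (pt a, pt b) (pt c, pt d) = k9 a b c d) ->
    base_sqr k9 m ->
  forall p r, \sum_q k p q * k q r = m * k p r.
Proof.
move=> inv diag k_pt base; apply: ker_sqr => // -[r r'].
have [c c10 ->] := pt_surj i0_sqr r; have [d d10 ->] := pt_surj i0_sqr r'.
have -> : Some 0 = pt 0 by rewrite -[pt 0]/(Some (dec 0)) dec0.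
rewrite -[None]/(pt 9) (sum_pairs i0_sqr) k_pt //.
rewrite -(eqP (all_iotaP (all_iotaP base c10) d10)).
by apply: eq_sum10 => a a10; apply: eq_sum10 => b b10; rewrite !k_pt.
Qed.

Lemma ker20_sqr p r : \sum_q ker20 p q * ker20 q r = 36 * ker20 p r.
Proof.
apply: ker_sqr9 p r => [e s p q|||]; first exact: ker20_perm.
- exact: ker20_diag.
- exact: ker20_pt.
- exact: base_sqr20.
Qed.

Lemma ker16_sqr p r : \sum_q ker16 p q * ker16 q r = 180 * ker16 p r.
Proof.
apply: ker_sqr9 p r => [e s p q|||]; first exact: ker16_perm.
- exact: ker16_diag.
- exact: ker16_pt.
- exact: base_sqr16.
Qed.

Definition probe (i : 'I_6) : T :=
  (pt (nth (0, 0)%N probes i).1, pt (nth (0, 0)%N probes i).2).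

(** With [probe], these are the functions [F] and the points [pt] of the general argument. *)
Definition mod3_form (i : 'I_6) (p : T) : int :=
  \sum_(t <- nth [::] triangles i)
    t.1 * triangle (pt t.2.1.1) (pt t.2.1.2) (pt t.2.2) p.

Lemma mod3_form_sum i p :
  \sum_q (5 * ker20 p q + ker16 p q) * mod3_form i q = 180 * mod3_form i p.
Proof.
rewrite mulr_sumr; under eq_bigr do rewrite mulr_sumr.
rewrite exchange_big /=; apply: eq_bigr => t _.
by rewrite mulrCA -ker_sum_triangle mulr_sumr; apply: eq_bigr => q _; ring.
Qed.

Lemma image9E (i : 'I_6) a b : (a < 10)%N -> (b < 10)%N ->
  \sum_q ker20 (pt a, pt b) q * mod3_form i q =
  nth 0 (nth [::] (nth [::] image_tab i) a) b.
Proof.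
move=> a10 b10; transitivity (image9 i a b); last first.
  apply/eqP; move: b b10; apply: all_iotaP; move: a a10; apply: all_iotaP.
  move: (nat_of_ord i) (ltn_ord i); apply: all_iotaP.
  by vm_compute.
under eq_bigr do rewrite mulr_sumr.
rewrite exchange_big /= /image9.
have : all (fun t => [&& t.2.1.1 < 10, t.2.1.2 < 10 & t.2.2 < 10])%N (nth [::] triangles i).
  by move: (nat_of_ord i) (ltn_ord i); apply: all_iotaP.
elim: (nth [::] triangles i) => [|[z [[x y] w]] s IH] /=; first by rewrite big_nil.
move=> /andP[/and3P[x10 y10 w10] /IH sE]; rewrite big_cons sE; congr (_ + _).
rewrite /= -!ker20_pt // [2 * z]mulrC -mulrA -ker20_sum_triangle.
by rewrite !mulr_sumr; apply: eq_bigr => q _; ring.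
Qed.

End Decoding.

(** * Orders and traces of permutations read off from their tables *)

Section Tables.
Variable i0 : F9.
Hypothesis i0_sqr : i0 ^+ 2 = -1.
Local Notation pt := (pt i0).
Local Notation dec := (dec i0).

Section Row.
Variables (s : {perm P1}) (l : seq nat).
Hypothesis l_lt : forall k, (k < 10)%N -> (nth 0%N l k < 10)%N.
Hypothesis sE : forall k, (k < 10)%N -> s (pt k) = pt (nth 0%N l k).

Lemma iterates9E k : iterates9 l k = (s ^+ k == 1)%g.
Proof.
have iter_lt n p : (p < 10)%N -> (iter n (nth 0%N l) p < 10)%N.
  by move=> p10; elim: n => //= n; apply: l_lt.
have ptE p : (p < 10)%N -> (s ^+ k)%g (pt p) = pt (iter k (nth 0%N l) p).
  by move=> p10; rewrite permX; elim: k => //= n ->; rewrite sE ?iter_lt.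
apply/allP/eqP => [H|sk p]; last first.
  rewrite mem_iota => p10; apply/eqP; apply: (pt_inj i0_sqr); rewrite ?inE ?iter_lt //.
  by rewrite -ptE // sk perm1.
apply/permP => x; have [p p10 ->] := pt_surj i0_sqr x.
by rewrite ptE // perm1 (eqP (H p _)) // mem_iota.
Qed.

Lemma order9E : (order9 l <= 5)%N -> #[s]%g = order9 l.
Proof.
rewrite /order9; set r := [:: _; _; _; _; _]; set q := find _ _ => q5.
have nthE j : (j < 5)%N -> nth 0%N r j = j.+1 by case: j => [|[|[|[|[|j]]]]].
have s_ord : (#[s]%g <= q.+1)%N.
  rewrite dvdn_leq // order_dvdn -iterates9E -nthE //.
  by apply: nth_find; rewrite has_find.
case: (ltngtP #[s]%g q.+1) s_ord => // s_lt _.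
have s0 := order_gt0 s; have jq : (#[s]%g.-1 < q)%N by lia.
have := before_find 0%N jq; rewrite nthE ?prednK //; last by lia.
by rewrite iterates9E expg_order eqxx.
Qed.

Lemma order9_neq6 : odd_ok l -> #[s]%g != 6%N.
Proof.
rewrite /odd_ok !iterates9E -!order_dvdn => H; apply/eqP => s6.
by move: H; rewrite s6.
Qed.

Lemma ker_trace (k : T -> T -> int) (k9 : nat -> nat -> nat -> nat -> int) :
    (forall a b c d, (a < 10)%N -> (b < 10)%N -> (c < 10)%N -> (d < 10)%N ->
      k (pt a, pt b) (pt c, pt d) = k9 a b c d) ->
  \sum_p k (pair_perm s p) p =
  sum10 (fun a => sum10 (fun b => k9 (nth 0%N l a) (nth 0%N l b) a b)).
Proof.
move=> k_pt; rewrite (sum_pairs i0_sqr).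
apply: eq_sum10 => a a10; apply: eq_sum10 => b b10.
by rewrite permE /pair_fun /= !sE // k_pt ?l_lt.
Qed.

Lemma even_trace20 : even_ok l -> \sum_p ker20 (pair_perm s p) p = 36 * char20 #[s]%g.
Proof.
case/and4P => l5 /eqP H _ _; rewrite (order9E l5) -H.
by apply: ker_trace; apply: (ker20_pt i0_sqr).
Qed.

Lemma even_trace16 : even_ok l -> \sum_p ker16 (pair_perm s p) p = 180 * char16 #[s]%g.
Proof.
move=> lP; have t20 := even_trace20 lP; move: t20.
case/and4P: lP => l5 _ /eqP H _; rewrite (order9E l5) => t20.
have : \sum_p (10 * alt_ker (pair_perm s p) p - ker9 (pair_perm s p) p) =
    20 * (char20 (order9 l) + char16 (order9 l)).
  rewrite -H; apply: (@ker_trace (fun p q => 10 * alt_ker p q - ker9 p q)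
    (fun a b c d => 10 * alt9 a b c d - ker9_9 a b c d)) => a b c d *.
  by rewrite (alt_ker_pt i0_sqr) // (ker9_pt i0_sqr).
move=> t9; transitivity (9 * (\sum_p (10 * alt_ker (pair_perm s p) p -
    ker9 (pair_perm s p) p)) - 5 * \sum_p ker20 (pair_perm s p) p).
  by rewrite !mulr_sumr -sumrB; apply: eq_bigr => p _; rewrite /ker16; ring.
by rewrite t9 t20; ring.
Qed.

Lemma even_trace6 : even_ok l -> exists z : int,
  \sum_i \sum_q ker20 (pair_perm s (probe i0 i)) q * mod3_form i0 i q =
  char6 #[s]%g + 3 * z.
Proof.
case/and4P => l5 _ _ /eqP H; rewrite (order9E l5).
exists ((trace6 l - char6 (order9 l)) %/ 3)%Z.
transitivity (trace6 l); last first.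
  by have := divz_eq (trace6 l - char6 (order9 l)) 3; rewrite H; lia.
rewrite /trace6.
transitivity (\sum_(0 <= i < 6) nth 0 (nth [::] (nth [::] image_tab i)
     (nth 0%N l (nth (0, 0)%N probes i).1)) (nth 0%N l (nth (0, 0)%N probes i).2)).
  rewrite big_mkord; apply: eq_bigr => i _.
  have [a10 b10] : ((nth (0, 0)%N probes i).1 < 10)%N /\ ((nth (0, 0)%N probes i).2 < 10)%N.
    by case: i => -[|[|[|[|[|[|]]]]]].
  by rewrite permE /pair_fun /= !sE // (image9E i0_sqr) ?l_lt.
by rewrite /index_iota subn0 unlock.
Qed.

End Row.
End Tables.

(** Covers both groups: E is 1 for PGL(2,9) and the determinant for M10. *)
Definition is_twisted_frac (s : {perm P1}) : Prop :=
  exists E a b c d : F9, [/\ a * d - b * c != 0,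
    s =1 semilinear_frac (M10_twist E) a b c d &
    is_square (a * d - b * c) -> is_square E].

Lemma is_square_sqr (x : F9) : is_square (x ^+ 2).
Proof. by apply/is_squareP; exists x. Qed.

(** Divide the matrix by c, or by d if c = 0; the determinant changes by a square. *)
Lemma twisted_frac_normal (s : {perm P1}) : is_twisted_frac s ->
  exists E a b c d : F9, [/\ a * d - b * c != 0,
    s =1 semilinear_frac (M10_twist E) a b c d,
    is_square (a * d - b * c) -> is_square E &
    (c == 0) && (d == 1) || (c == 1)].
Proof.
move=> [E [a [b [c [d [D0 sE ED]]]]]].
pose k := if c == 0 then d else c.
have k0 : k != 0.
  rewrite /k; case: (eqVneq c 0) => // c0; apply/eqP => d0; case/eqP: D0.
  by rewrite c0 d0 !mulr0 subrr.
have kV0 : k^-1 != 0 by rewrite invr_eq0.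
have DE : k^-1 * a * (k^-1 * d) - k^-1 * b * (k^-1 * c) = k^-1 ^+ 2 * (a * d - b * c).
  by ring.
exists E, (k^-1 * a), (k^-1 * b), (k^-1 * c), (k^-1 * d); rewrite DE; split.
- by rewrite mulf_neq0 ?expf_neq0.
- by move=> p; rewrite sE !semilinear_fracE -!mulrA -!mulrDr homog_pointZ.
- by rewrite is_squareM ?expf_neq0 // is_square_sqr => /eqP/esym.
rewrite /k in k0 *; case: (eqVneq c 0) k0 => [->|c0] k0; last by rewrite mulVf ?eqxx ?orbT.
by rewrite mulr0 mulVf ?eqxx.
Qed.

Section Row.
Variable i0 : F9.
Hypothesis i0_sqr : i0 ^+ 2 = -1.
Local Notation pt := (pt i0).
Local Notation dec := (dec i0).

Lemma frac9_lt t a b c d k : (frac9 t a b c d k < 10)%N.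
Proof. by rewrite /frac9 /point9; case: ifP => // _; apply: leqW; apply: mul9_lt. Qed.

Lemma nth_row9 t a b c d k : (k < 10)%N ->
  nth 0%N (row9 t a b c d) k = frac9 t a b c d k.
Proof. by move=> k10; rewrite (nth_map 0%N) ?size_iota // nth_iota. Qed.

Lemma twisted_frac_row (s : {perm P1}) : is_twisted_frac s -> exists l,
  [/\ forall k, (k < 10)%N -> (nth 0%N l k < 10)%N,
      forall k, (k < 10)%N -> s (pt k) = pt (nth 0%N l k) &
      if tau s == -1 then odd_ok l else even_ok l].
Proof.
move=> /twisted_frac_normal[E [a [b [c [d [D0 sE ED norm]]]]]].
have := switching_tau (switching_frac D0 sE); rewrite /quad (negPf D0) => ->.
have [a9 a9_lt aE] := dec_surj i0_sqr a; have [b9 b9_lt bE] := dec_surj i0_sqr b.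
have [c9 c9_lt cE] := dec_surj i0_sqr c; have [d9 d9_lt dE] := dec_surj i0_sqr d.
have detE : dec (det9 a9 b9 c9 d9) = a * d - b * c.
  by rewrite dec_add !dec_mul // dec6 mulN1r aE bE cE dE.
have det_lt : (det9 a9 b9 c9 d9 < 9)%N by apply: add9_lt.
have det0 : det9 a9 b9 c9 d9 != 0%N by rewrite -(dec_eq0 i0_sqr) // detE.
have norm9 : (c9 == 0%N) && (d9 == 3%N) || (c9 == 3%N).
  have dec_eq x y : (x < 9)%N -> (y < 9)%N -> dec x == dec y -> x == y.
    by move=> x9 y9 /eqP/(dec9_inj i0_sqr) xy; apply/eqP/xy.
  move: norm; rewrite cE dE -(dec3 i0) -(dec0 i0).
  case/orP=> [/andP[/dec_eq -> // /dec_eq -> //]|/dec_eq -> //].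
  by rewrite orbT.
have := nonsingularP all_row_ok a9_lt b9_lt d9_lt norm9 det0.
rewrite /row_ok -(is_square_dec i0_sqr) // detE => rowP.
exists (row9 (~~ is_square E) a9 b9 c9 d9); split=> [k k10|k k10|].
- by rewrite nth_row9 ?frac9_lt.
- rewrite nth_row9 // sE aE bE cE dE.
  by apply: (frac_dec i0_sqr) => //; rewrite negbK.
case: (is_square (a * d - b * c)) rowP ED => [ok /(_ isT) ->|/andP[ok1 ok2] _].
  exact: ok.
by case: (is_square E); [exact: ok1 | exact: ok2].
Qed.

End Row.

(** * Groups of twisted fractional maps, and the two groups of the theorem *)

Section Action.
Variables (gT : finGroupType) (rho : gT -> {perm P1}).
Hypothesis rhoM : {morph rho : g h / (g * h)%g}.
Hypothesis rho_inj : injective rho.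
Hypothesis rho_frac : forall g, is_twisted_frac (rho g).

Lemma rho1 : rho 1%g = 1%g.
Proof. by apply: (mulgI (rho 1%g)); rewrite -rhoM !mulg1. Qed.

Lemma order_rho g : #[rho g]%g = #[g]%g.
Proof.
have rhoX n : rho (g ^+ n)%g = (rho g ^+ n)%g.
  by elim: n => [|n IH]; rewrite ?expg0 ?rho1 // !expgS rhoM IH.
apply/eqP; rewrite eqn_dvd !order_dvdn -rhoX expg_order rho1 eqxx /=.
by rewrite -(inj_eq rho_inj) rhoX expg_order rho1.
Qed.

Lemma rho_switching g : exists2 e, switching e (rho g) & e = 1 \/ e = -1.
Proof.
have [E [a [b [c [d [D0 sE _]]]]]] := rho_frac g.
exists (quad (a * d - b * c)); first exact: switching_frac sE.
by rewrite /quad (negPf D0); case: ifP; [left | right].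
Qed.

Theorem no_unit_order6_of_action (u : group_ring int gT) : augmentation u = 1 ->
  u ^+ 6 = 1 -> u ^+ 2 <> 1 -> u ^+ 3 <> 1 -> False.
Proof.
have [i0 i0_sqr] := F9_sqrtN1.
(* [chi] is false exactly on the maps of square determinant. *)
pose chi g := tau (rho g) == -1.
have row g : exists l, [/\ forall k, (k < 10)%N -> (nth 0%N l k < 10)%N,
    forall k, (k < 10)%N -> rho g (pt i0 k) = pt i0 (nth 0%N l k) &
    if chi g then odd_ok l else even_ok l] := twisted_frac_row i0_sqr (rho_frac g).
have perm_row (k : T -> T -> int) : (forall e s p q, switching e s ->
    k (pair_perm s p) (pair_perm s q) = k p q) ->
    forall g p q, k (pair_perm (rho g) p) (pair_perm (rho g) q) = k p q.
  by move=> inv g p q; have [e sw _] := rho_switching g; apply: inv sw.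
apply: (@no_unit_order6_of_kernels _ chi _ _ _ _ (fun g => pair_perm (rho g)) ker20 ker16
  _ _ _ _ _ _ _ _ (mod3_form i0) (probe i0)).
- move=> g h; have [e sw eE] := rho_switching g; have [f sw' fE] := rho_switching h.
  rewrite /chi rhoM (switching_tau (switchingM sw sw')) (switching_tau sw).
  by rewrite (switching_tau sw'); case: eE fE => -> [] ->.
- move=> g /negPf chig; have [l [l_lt sE]] := row g; rewrite chig.
  by case/and4P => l5 _ _ _; rewrite -order_rho (order9E i0_sqr l_lt sE).
- move=> g; have [l [l_lt sE]] := row g; rewrite -order_rho.
  case: (chi g) => [|/and4P[l5 _ _ _]]; first exact: (order9_neq6 i0_sqr l_lt sE).
  by rewrite (order9E i0_sqr l_lt sE) //; apply: contraTneq l5 => ->.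
- by move=> g h; rewrite rhoM pair_permM.
- by apply: perm_row => e s p q; apply: ker20_perm.
- by apply: perm_row => e s p q; apply: ker16_perm.
- exact: ker20_sqr i0_sqr.
- exact: ker16_sqr i0_sqr.
- move=> g /negPf chig; have [l [l_lt sE]] := row g; rewrite chig -order_rho.
  by move/(even_trace20 i0_sqr l_lt sE).
- move=> g /negPf chig; have [l [l_lt sE]] := row g; rewrite chig -order_rho.
  by move/(even_trace16 i0_sqr l_lt sE).
- exact: mod3_form_sum.
- move=> g /negPf chig; have [l [l_lt sE]] := row g; rewrite chig -order_rho.
  by move/(even_trace6 i0_sqr l_lt sE).
Qed.

End Action.

Lemma is_square1 : is_square 1.
Proof. by rewrite -(expr1n _ 2) is_square_sqr. Qed.

Lemma M10_twist_square E : is_square E -> M10_twist E =1 id.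
Proof. by rewrite /M10_twist => ->. Qed.

Lemma det_mx22 (R : comNzRingType) (A : 'M[R]_2) :
  \det A = A 0 0 * A 1 1 - A 0 1 * A 1 0.
Proof.
rewrite (expand_det_row _ 0) !big_ord_recl big_ord0 /cofactor !det_mx11 !mxE addr0.
have -> : lift 0 0 = 1 :> 'I_2 by apply: val_inj.
have -> : lift 1 0 = 0 :> 'I_2 by apply: val_inj.
by rewrite /= expr0 expr1 mul1r mulN1r mulrN.
Qed.

Local Notation GL2 := {'GL_2[F9]}.

Lemma GL2_det_neq0 (A : GL2) : A 0 0 * A 1 1 - A 1 0 * A 0 1 != 0.
Proof. by have := GL_det A; rewrite det_mx22 [A 0 1 * _]mulrC. Qed.

(* The row vector (x, y) represents the point (x : y), and GL2 acts on rows   *)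
(* from the right.                                                            *)
Definition GL2_perm (A : GL2) : {perm P1} := frac_perm 1 (GL2_det_neq0 A).

Lemma GL2_permE A p : GL2_perm A p =
  homog_point ((homog_coord p).1 * A 0 0 + (homog_coord p).2 * A 1 0)
              ((homog_coord p).1 * A 0 1 + (homog_coord p).2 * A 1 1).
Proof.
rewrite permE semilinear_fracE !(M10_twist_square is_square1).
by rewrite ![_ * A _ _]mulrC.
Qed.

Lemma GL2_mulE (A B : GL2) i j :
  GLval (A * B)%g i j = A i 0 * B 0 j + A i 1 * B 1 j.
Proof. by rewrite GL_MxE mxE !big_ord_recl big_ord0 addr0 (_ : lift _ _ = 1) //; apply: val_inj. Qed.

Lemma GL2_permM (A B : GL2) : GL2_perm (A * B)%g = (GL2_perm A * GL2_perm B)%g.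
Proof.
apply/permP => p; rewrite permM !GL2_permE.
set x := (homog_coord p).1; set y := (homog_coord p).2.
have XY0 : (x * A 0 0 + y * A 1 0 != 0) || (x * A 0 1 + y * A 1 1 != 0).
  have := det2_neq0 (GL2_det_neq0 A) (homog_coord_neq0 p).
  by rewrite -/x -/y ![A _ _ * _]mulrC.
have [k k0 [XE YE]] := homog_coord_point XY0; set q := homog_point _ _ in XE YE *.
rewrite -[RHS](homog_pointZ _ _ k0) !mulrDr !mulrA -XE -YE.
by rewrite !GL2_mulE; congr homog_point; ring.
Qed.

Lemma GL2_center (A : GL2) : (A \in 'Z('GL_2[F9]))%g =
  [&& A 0 1 == 0, A 1 0 == 0 & A 0 0 == A 1 1].
Proof.
have ord2 (i : 'I_2) : i = 0 \/ i = 1.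
  by case: i => -[|[|//]] lt; [left | right]; apply: val_inj.
apply/idP/and3P => [/centerP[_ AC]|[/eqP A01 /eqP A10 /eqP A00]]; last first.
  apply/centerP; split=> [|B _]; first by rewrite inE.
  have scal : GLval A = (A 1 1)%:M.
    apply/matrixP => i j; rewrite mxE.
    by case: (ord2 i) => ->; case: (ord2 j) => ->; rewrite ?A01 ?A10 ?A00.
  by apply: val_inj; rewrite -[LHS]/(A *m GLval B) -[RHS]/(GLval B *m A) scal scalar_mxC.
(* The test matrices have diagonal 1 and off-diagonal entries x, y; their determinant is 1 because x
   y = 0. *)
have commutes (x y : F9) : x * y = 0 -> exists B : GL2,
    [/\ commute A B, B 0 0 = 1, B 0 1 = x, B 1 0 = y & B 1 1 = 1].
  move=> xy0; pose t : 'M[F9]_2 := \matrix_(i, j)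
    if i == j then 1 else if i == 0 then x else y.
  have tU : t \is a GRing.unit.
    by rewrite -[_ \is a _]/(t \in unitmx) unitmxE det_mx22 !mxE /= xy0 mulr1 subr0 unitr1.
  by exists (FinRing.unit _ tU); split; rewrite ?[GLval _ _ _]mxE //; apply: AC; rewrite inE.
have [B [/(congr1 GLval)/matrixP AB B00 B01 B10 B11]] := commutes 1 0 (mulr0 1).
have [C [/(congr1 GLval)/matrixP AC' C00 C01 C10 _]] := commutes 0 1 (mul0r 1).
have := AB 0 0; have := AB 0 1; have := AC' 0 0.
rewrite !GL2_mulE B00 B01 B10 B11 C00 C01 C10 !(mulr0, mul0r, mulr1, mul1r, addr0).
move/(canRL (addKr _)); rewrite addNr => ->; rewrite addr0 add0r => -> /esym.
by move/(canRL (addKr _)); rewrite addNr => ->; rewrite eqxx.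
Qed.

(** Fixing infinity, 0 and 1 makes A lower triangular, then diagonal, then scalar. *)
Lemma GL2_perm_center (A : GL2) : (GL2_perm A == 1%g) = (A \in 'Z('GL_2[F9])%g).
Proof.
rewrite GL2_center; apply/eqP/and3P => [A1|[/eqP A01 /eqP A10 /eqP A00]].
  have AE p : GL2_perm A p = p by rewrite A1 perm1.
  have A01 : A 0 1 = 0.
    have := AE None; rewrite GL2_permE /= /homog_point.
    by rewrite !mul0r !mul1r !addr0; case: eqP.
  have A10 : A 1 0 = 0.
    have := AE (Some 0); rewrite GL2_permE /= /homog_point.
    rewrite A01 !mul0r !mul1r !add0r; case: eqP => // A11 [] /eqP.
    by rewrite mulf_eq0 invr_eq0 => /orP[/eqP|/eqP/A11].
  have := AE (Some 1); rewrite GL2_permE /= /homog_point A01 A10 !mul1r addr0 add0r.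
  by case: eqP => // /eqP A11 [] A00; rewrite eqxx; split=> //; rewrite -(divfK A11 (A 0 0)) A00 mul1r.
apply/permP => p; rewrite GL2_permE perm1 A01 A10 A00 !mulr0 addr0 add0r.
have A11 : A 1 1 != 0.
  by have := GL2_det_neq0 A; rewrite A10 mul0r subr0 mulf_eq0 negb_or => /andP[].
rewrite ![_ * A 1 1]mulrC homog_pointZ //.
by case: p => [x|] /=; rewrite /homog_point ?oner_eq0 ?eqxx // divr1.
Qed.

Theorem no_unit_M10 (u : ZG M10) : augmentation u = 1 ->
  u ^+ 6 = 1 -> u ^+ 2 <> 1 -> u ^+ 3 <> 1 -> False.
Proof.
apply: (@no_unit_order6_of_action _ (fun g : subg_of M10 => sgval g)).
- by move=> g h; rewrite sgvalM ?inE.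
- exact: val_inj.
- move=> g; have /M10_setP[a [b [c [d [D0 sE]]]]] := subgP g.
  by exists (a * d - b * c), a, b, c, d.
Qed.

(** A coset acts through a representative; since the kernel of the action is the centre, the choice
    does not matter and the action is faithful. *)
Theorem no_unit_PGL29 (u : ZG PGL29) : augmentation u = 1 ->
  u ^+ 6 = 1 -> u ^+ 2 <> 1 -> u ^+ 3 <> 1 -> False.
Proof.
pose rep (g : subg_of PGL29) : GL2 := repr (sgval g).
have norm A : A \in 'N('Z('GL_2[F9]))%g.
  by apply: (subsetP (normal_norm (center_normal _))); rewrite inE.
have repK g : coset 'Z('GL_2[F9]) (rep g) = sgval g by apply: coset_reprK.
have perm_coset A B : coset 'Z('GL_2[F9]) A = coset 'Z('GL_2[F9]) B <->
    GL2_perm A = GL2_perm B.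
  transitivity (A * B^-1 \in 'Z('GL_2[F9]))%g.
    rewrite -mem_rcoset; split; first by move/(rcoset_kercosetP (norm A) (norm B)).
    by move=> ?; apply/(rcoset_kercosetP (norm A) (norm B)).
  rewrite -GL2_perm_center.
  have -> : GL2_perm A = (GL2_perm (A * B^-1)%g * GL2_perm B)%g.
    by rewrite -GL2_permM mulgKV.
  by split=> [/eqP ->|]; [rewrite mul1g | rewrite -{2}[GL2_perm B]mul1g => /mulIg/eqP].
apply: (@no_unit_order6_of_action _ (fun g => GL2_perm (rep g))).
- move=> g h; rewrite -GL2_permM; apply/perm_coset.
  transitivity (coset 'Z('GL_2[F9]) (rep g) * coset 'Z('GL_2[F9]) (rep h))%g.
    by rewrite !repK sgvalM ?inE.
  by apply/esym/morphM; apply: norm.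
- by move=> g h /perm_coset; rewrite !repK => /val_inj.
- move=> g; eexists 1, _, _, _, _; split; first exact: GL2_det_neq0 (rep g).
    by move=> p; rewrite permE.
  by rewrite is_square1.
Qed.

Theorem theorem2 :
  (~ exists u : ZG M10, normalized_unit u /\ has_order u 6) /\
  (~ exists u : ZG PGL29, normalized_unit u /\ has_order u 6).
Proof.
split=> -[u [[_ aug] [_ u6 u_neq1]]].
  by apply: (no_unit_M10 aug u6); apply: u_neq1.
by apply: (no_unit_PGL29 aug u6); apply: u_neq1.
Qed.
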